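(* Let $R$ be a region obtained from a lattice hexagon by removing a system of pairwise disjoint ferns having a common horizontal axis, and let $Q$ be a region obtained from $R$ by a sequence of lobe squeezings. Then $$\frac{\operatorname{M}(R)}{\operatorname{M}(Q)}=\frac{\operatorname{w}^{(R)}\,\dfrac{\prod_{A\text{ node of }R}\operatorname{k}_A^{(R)}}{\prod_{L\text{ support line of }R}\operatorname{k}_L^{(R)}}}{\operatorname{w}^{(Q)}\,\dfrac{\prod_{A\text{ node of }Q}\operatorname{k}_A^{(Q)}}{\prod_{L\text{ support line of }Q}\operatorname{k}_L^{(Q)}}}.$$
   Context: The triangular lattice is drawn with one family of lattice lines horizontal; $\operatorname{M}(R)$ is the number of lozenge tilings of $R$. A fern is a union of finitely many lattice triangles (lobes) of alternating orientations (up/down), lined up along a horizontal lattice line (its axis) with their horizontal sides on that line, consecutive lobes meeting at a single point of the axis. A node of $R$ is a point where two lobes of the removed ferns meet. A support line of $R$ is a lattice line containing an edge of at least two lobes (this includes the common axis). Distances between a point or a lattice line and a side of the outer hexagon are measured in units of the spacing between consecutive parallel lattice lines. Let $\operatorname{h}(n)=0!\,1!\cdots(n-1)!$. Point couple: at a node $A$ the two lobes meeting at $A$ lie in a $60^\circ$ double cone with vertex $A$; $\operatorname{k}_A^{(R)}=\operatorname{h}(u)\operatorname{h}(d)$, where $u,d$ are the distances from $A$ to the pair of opposite sides of the outer hexagon toward which this double cone points. Line couple: $\operatorname{k}_L^{(R)}=\operatorname{h}(u)\operatorname{h}(d)$, where $u,d$ are the distances from $L$ to the two sides of the outer hexagon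 parallel to $L$. Weight: label the unit lattice segments of the common axis lying inside $R$ by $1,2,3,\dots$ from left to right; let $I$ be the set of labels of segments on the horizontal sides of down-pointing lobes and $J$ that for up-pointing lobes; $\operatorname{w}^{(R)}=\Delta(I)\Delta(J)$ with $\Delta(\{s_1<\dots<s_k\})=\prod_{1\le i<j\le k}(s_j-s_i)$. Lobe squeezing: given a node $A$ and $d$ a positive integer not exceeding the side of the lobe to the left of $A$, the region obtained by squeezing the lobe left of $A$ into the lobe right of $A$ by $d$ units is the region $Q$ such that: (1) $Q$ is a hexagon with a system of co-axial ferns removed; (2) the outer hexagon of $Q$ is obtained from that of $R$ by pushing in by $d$ units the three sides at the back with respect to the direction of squeezing and pushing out by $d$ units the other three sides; (3) the ferns of $Q$ are obtained from those of $R$ by keeping $A$ fixed, shrinking the lobe to the left of $A$ by $d$ units while dragging along the portion of the fern system to the left of it, inflating the lobe to the right of $A$ by $d$ units, and translating the entire remaining portion of the fern system to the right of that lobe $d$ units to the right.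
   Formalization: A lobe squeezed down to side 0 is kept in Q as a degenerate lobe, with its nodes and support lines counted (coinciding ones with multiplicity), since the formula fails if they are dropped; M(Q) is assumed nonzero so that the quotient makes sense. *)

(* Defs.v *)
From HB Require Import structures.
From Stdlib Require Export Relation_Operators.
From mathcomp Require Export all_boot all_order all_algebra.
From mathcomp Require Export finmap.

Set Implicit Arguments.
Unset Strict Implicit.
Unset Printing Implicit Defensive.

Import Order.TTheory GRing.Theory Num.Theory.
Local Open Scope ring_scope.

(* The point (x, y) stands for x e1 + y e2, where e1 = (1, 0) and               *)
(* e2 = (1/2, sqrt 3/2).  The lattice lines are y = c (Horizontal), x = c       *)
(* (Rising, parallel to e2) and x + y = c (Falling, parallel to e2 - e1);       *)
(* consecutive parallel lattice lines have consecutive integers c, so that      *)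
(* distances in units of the spacing are differences of coordinates.            *)
Definition point : Type := (int * int)%type.

Variant family := Horizontal | Rising | Falling.

Definition nat_of_family (f : family) : nat :=
  match f with Horizontal => 0 | Rising => 1 | Falling => 2 end.
Definition family_of_nat (n : nat) : family :=
  match n with 0 => Horizontal | 1 => Rising | _ => Falling end%N.
Lemma nat_of_familyK : cancel nat_of_family family_of_nat.
Proof. by case. Qed.
HB.instance Definition _ := Equality.copy family (can_type nat_of_familyK).

Definition coord (f : family) (p : point) : int :=
  match f with
  | Horizontal => p.2
  | Rising => p.1
  | Falling => p.1 + p.2
  end.

(* (x, y, true) is the up-pointing unit triangle whose lower left corner is     *)
(* (x, y); (x, y, false) is the down-pointing one with which it forms the       *)
(* lattice parallelogram based at (x, y).                                       *)
Definition triangle : Type := (int * int * bool)%type.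

Definition vertices (t : triangle) : seq point :=
  let: (x, y, up) := t in
  if up then [:: (x, y); (x + 1, y); (x, y + 1)]
  else [:: (x + 1, y); (x, y + 1); (x + 1, y + 1)].

Definition share_edge (t t' : triangle) : bool :=
  count (mem (vertices t)) (vertices t') == 2%N.

Definition is_lozenge (R : {fset triangle}) (B : {set R}) : bool :=
  [exists t : R, exists t' : R,
     share_edge (val t) (val t') && (B == [set t; t'])].

Definition M (R : {fset triangle}) : nat :=
  #|[set P : {set {set R}} |
       partition P [set: R] & [forall B in P, is_lozenge B]]|.

(* The hexagon bot <= y <= top, nw <= x <= se, sw <= x + y <= ne, recorded by   *)
(* the lines supporting its bottom, top, north-western, south-eastern,          *)
(* south-western and north-eastern sides.                                       *)
Record hexagon := Hexagon { bot : int; top : int; nw : int; se : int;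
                            sw : int; ne : int }.

Definition lo (H : hexagon) (f : family) : int :=
  match f with Horizontal => bot H | Rising => nw H | Falling => sw H end.
Definition hi (H : hexagon) (f : family) : int :=
  match f with Horizontal => top H | Rising => se H | Falling => ne H end.

Definition in_hexagon (H : hexagon) (p : point) : bool :=
  all (fun f => lo H f <= coord f p <= hi H f) [:: Horizontal; Rising; Falling].

(* Lengths of the sides: top, bottom, nw, se, sw, ne.                           *)
Definition side_lengths (H : hexagon) : seq int :=
  [:: ne H - top H - nw H; se H + bot H - sw H; top H + nw H - sw H;
      ne H - se H - bot H; sw H - nw H - bot H; top H + se H - ne H].

(* A fern is given by the abscissa of its left end on the axis, the orientation *)
(* of its leftmost lobe, and the sides of its lobes from left to right.         *)
(* Squeezing may shrink a lobe to side 0; it is then kept as a degenerate lobe. *)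
Record fern := Fern { fern_left : int; fern_up : bool; fern_sides : seq nat }.

Definition fern_right (f : fern) : int :=
  fern_left f + (sumn (fern_sides f))%:Z.

(* lobe_rank is the position of the lobe in its fern, starting from 0.          *)
Record lobe := Lobe { lobe_left : int; lobe_side : nat; lobe_up : bool;
                      lobe_rank : nat }.

Definition lobe_right (l : lobe) : int := lobe_left l + (lobe_side l)%:Z.

Fixpoint lobes_from (x : int) (up : bool) (j : nat) (s : seq nat) : seq lobe :=
  if s is a :: s' then Lobe x a up j :: lobes_from (x + a%:Z) (~~ up) j.+1 s'
  else [::].

Definition fern_lobes (f : fern) : seq lobe :=
  lobes_from (fern_left f) (fern_up f) 0 (fern_sides f).

Record config := Config { outer : hexagon; axis : int; ferns : seq fern }.

Definition lobes (C : config) : seq lobe := flatten (map fern_lobes (ferns C)).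

Definition lobe_vertices (C : config) (l : lobe) : seq point :=
  [:: (lobe_left l, axis C); (lobe_right l, axis C);
      if lobe_up l then (lobe_left l, axis C + (lobe_side l)%:Z)
      else (lobe_right l, axis C - (lobe_side l)%:Z)].

Definition in_lobe (C : config) (l : lobe) (p : point) : bool :=
  if lobe_up l then
    [&& axis C <= p.2, lobe_left l <= p.1 & p.1 + p.2 <= lobe_right l + axis C]
  else
    [&& p.2 <= axis C, p.1 <= lobe_right l & lobe_left l + axis C <= p.1 + p.2].

(* The ferns are listed from left to right.  Lobes of different ferns can only  *)
(* meet on the axis, so disjointness of the ferns is strict separation of their *)
(* traces on the axis.                                                          *)
Definition coaxial (C : config) : bool :=
  [&& all (fun s => 0 <= s) (side_lengths (outer C)),
      all (fun f => fern_sides f != [::]) (ferns C),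
      sorted (fun f g => fern_right f < fern_left g) (ferns C)
    & all (fun l => all (in_hexagon (outer C)) (lobe_vertices C l)) (lobes C)].

Definition nondegenerate (C : config) : bool :=
  all (fun l => 0 < lobe_side l)%N (lobes C).

Definition box_triangles (H : hexagon) : seq triangle :=
  [seq (ij.1, ij.2, up)
  | ij <- [seq (nw H + i%:Z, bot H + j%:Z) | i <- iota 0 `|se H - nw H|%N,
                                             j <- iota 0 `|top H - bot H|%N],
    up <- [:: true; false]].

Definition region (C : config) : {fset triangle} :=
  [fset t in box_triangles (outer C)
  | all (in_hexagon (outer C)) (vertices t)
    && ~~ has (fun l => all (in_lobe C l) (vertices t)) (lobes C)]%fset.

Definition hfact (n : nat) : nat := \prod_(i < n) i`!.

Definition couple (H : hexagon) (f : family) (c : int) : nat :=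
  (hfact `|c - lo H f| * hfact `|hi H f - c|)%N.

(* The nodes, each given by the lobe on its left and the lobe on its right.     *)
Definition nodes (C : config) : seq (lobe * lobe) :=
  flatten [seq zip (fern_lobes f) (behead (fern_lobes f)) | f <- ferns C].

Definition node_point (C : config) (A : lobe * lobe) : point :=
  (lobe_right A.1, axis C).

(* If the left lobe points up and the right one down, then the double cone lies *)
(* between the horizontal and the falling line through the node, and points     *)
(* towards the nw and se sides, which are rising; in the other case it points   *)
(* towards the sw and ne sides.                                                 *)
Definition cone_sides (A : lobe * lobe) : family :=
  if lobe_up A.1 then Rising else Falling.

Definition node_couple (C : config) (A : lobe * lobe) : nat :=
  couple (outer C) (cone_sides A) (coord (cone_sides A) (node_point C A)).

(* (f, c, j) is the line coord f p = c.  The mark j matters only in the         *)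
(* presence of degenerate lobes: the two oblique edges of a lobe are marked by  *)
(* the ranks in the fern of its left and right ends, so that lines through      *)
(* different nodes remain distinct when the nodes come to coincide.  Without    *)
(* degenerate lobes j is determined by f and c.                                 *)
Definition line : Type := (family * int * nat)%type.

Definition axis_line (C : config) : line := (Horizontal, axis C, 0%N).

Definition edge_lines (C : config) (l : lobe) : seq line :=
  let fl := if lobe_up l then Rising else Falling in
  let fr := if lobe_up l then Falling else Rising in
  [:: axis_line C; (fl, coord fl (lobe_left l, axis C), lobe_rank l);
      (fr, coord fr (lobe_right l, axis C), (lobe_rank l).+1)].

Definition support_lines (C : config) : seq line :=
  [seq L <- undup (axis_line C :: flatten (map (edge_lines C) (lobes C)))
  | (L == axis_line C) || (1 < count (fun l => L \in edge_lines C l) (lobes C))%N].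

Definition line_couple (C : config) (L : line) : nat :=
  let: (f, c, _) := L in couple (outer C) f c.

(* The part of the axis inside the hexagon is axis_left <= x <= axis_right, and *)
(* the segment labelled k is axis_left + k - 1 <= x <= axis_left + k.           *)
Definition axis_left (C : config) : int :=
  Num.max (nw (outer C)) (sw (outer C) - axis C).
Definition axis_right (C : config) : int :=
  Num.min (se (outer C)) (ne (outer C) - axis C).

Definition labels (C : config) (up : bool) : seq nat :=
  [seq k <- iota 1 `|axis_right C - axis_left C|%N
  | has (fun l => (lobe_up l == up)
           && (lobe_left l <= axis_left C + k%:Z - 1 < lobe_right l)) (lobes C)].

Definition Delta (s : seq nat) : rat :=
  \prod_(j < size s) \prod_(i < j) ((nth 0%N s j)%:R - (nth 0%N s i)%:R).

Definition weight (C : config) : rat :=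
  Delta (labels C false) * Delta (labels C true).

(* Squeezing goes from the lobe left of the node to the lobe right of it: when  *)
(* the left lobe points up this is towards the se side, and the sides at the    *)
(* back are sw, nw, top; when it points down, it is towards the ne side, and    *)
(* the sides at the back are nw, sw, bot.                                       *)
Definition squeeze_hexagon (left_up : bool) (d : int) (H : hexagon) : hexagon :=
  if left_up then
    Hexagon (bot H - d) (top H - d) (nw H + d) (se H + d) (sw H + d) (ne H + d)
  else
    Hexagon (bot H + d) (top H + d) (nw H + d) (se H + d) (sw H + d) (ne H + d).

Definition shift_fern (d : int) (f : fern) : fern :=
  Fern (fern_left f + d) (fern_up f) (fern_sides f).

(* The node is the one between the lobes of sides a and b.  Since it stays      *)
(* fixed while the lobe of side a shrinks by d, everything to the left of that  *)
(* lobe moves d units to the right, including the left end x of the fern.       *)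
Variant squeeze (R Q : config) : Prop :=
  Squeeze (F1 F2 : seq fern) (x : int) (up : bool) (s1 s2 : seq nat)
    (a b d : nat) of
    ferns R = F1 ++ Fern x up (s1 ++ [:: a, b & s2]) :: F2 &
    (0 < d <= a)%N &
    coaxial Q &
    outer Q = squeeze_hexagon (up (+) odd (size s1)) d%:Z (outer R) &
    axis Q = axis R &
    ferns Q = map (shift_fern d%:Z) F1
              ++ Fern (x + d%:Z) up (s1 ++ [:: (a - d)%N, (b + d)%N & s2])
              :: map (shift_fern d%:Z) F2.

Definition squeezings : config -> config -> Prop := clos_refl_trans_1n config squeeze.

(* Main.v *)
Require Import Defs.
From HB Require Import structures.
From mathcomp Require Import zify ring.

(* Cut the region along the axis.  The parts above and below become trapezoids
   with triangular dents along the axis, once the corners of the hexagon that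
   are missing are regarded as further lobes, so that by the formula of Cohn,
   Larsen and Propp a tiling whose lozenges cross the axis at the positions K is
   counted by Vandermonde products of K + J and of K + I, where J and I are the
   positions covered by the up- and down-pointing lobes.  Hence the number of
   tilings is V(J) V(I) / (h(u) h(v)) times a sum over K which only involves the
   union of J and I, and squeezing merely translates that union.  The factors of
   V(J) V(I) due to the missing corners telescope along each fern: they leave at
   every node the ratio of its couple and that of the support line through it,
   and contributions of the ends of the ferns, which are translated as well. *)

Set Implicit Arguments.
Unset Strict Implicit.
Unset Printing Implicit Defensive.

Import Order.TTheory GRing.Theory Num.Theory.
Local Open Scope ring_scope.

(** * Perfect matchings and lozenge tilings *)

(** The trapezoid count is proved by sweeping the bottom row from left to right: each dent gives a
    row of binomial coefficients, and each choice made in the sweep is a linear relation between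
    rows of one determinant. Distances are taken in absolute value, so that unions of positions may
    be listed in any order. For fixed K the identity V(K+J) V(K+I) = V(K)^2 V(J) V(I) D(K, J+I),
    with D the product of all distances between two families, is what separates J from I. The
    orientations could still enter through the prescribed size of K, namely the height of a half
    minus the number of positions covered in it; squeezing changes both by the same amount, which is
    why the hexagon has to move together with the lobes. M is written as an explicit nonzero weight
    times an invariant, so that no tiling count is inverted along a sequence of squeezings. Lobes of
    side 0 may arise on the way and are kept: nodes and oblique support lines then stay in bijection
    throughout. *)

Section Matchings.
Variables (T : finType) (e : rel T).
Implicit Types (A B : {set T}) (P : {set {set T}}).

Definition dominos P :=
  [forall B in P, [exists t, exists t', e t t' && (B == [set t; t'])]].

Definition matchings A : {set {set {set T}}} :=
  [set P | partition P A & dominos P].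

Lemma matchings0 : #|matchings set0| = 1%N.
Proof.
rewrite (_ : matchings set0 = [set set0]) ?cards1 //.
apply/setP => P; rewrite !inE partition_set0 andb_idr // => /eqP ->.
by apply/forall_inP => B; rewrite inE.
Qed.

Hypotheses (esym : symmetric e) (eirr : irreflexive e).

Lemma dominosP P B : dominos P -> B \in P ->
  forall t, t \in B -> exists2 t', e t t' & B = [set t; t'].
Proof.
move=> /forall_inP dP /dP /existsP[u /existsP[v /andP[uv /eqP ->]]] t.
by rewrite !inE => /orP[] /eqP ->; [exists v | exists u; rewrite 1?esym // setUC].
Qed.

Lemma card_matchings_block A t t' : t \in A -> t' \in A -> e t t' ->
  #|[set P in matchings A | [set t; t'] \in P]| = #|matchings (A :\: [set t; t'])|.
Proof.
move=> tA t'A tt'; set B := [set t; t'].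
have BA : B \subset A by apply/subsetP => x; rewrite !inE => /orP[] /eqP ->.
have B0 : B != set0 by apply/set0Pn; exists t; rewrite !inE eqxx.
have BnP P : P \in matchings (A :\: B) -> B \notin P.
  rewrite inE => /andP[pP _]; apply/negP => /(partitionS pP).
  by move=> /subsetP/(_ t); rewrite !inE eqxx => /(_ isT).
rewrite -(card_in_imset (f := fun P => P :\ B)); last first.
  move=> P P'; rewrite !inE => /andP[_ BP] /andP[_ BP'] eqP.
  by rewrite -(setD1K BP) eqP setD1K.
apply: eq_card => P; apply/imsetP/idP => [[P']|Pm].
  rewrite !inE => /andP[/andP[pP' dP'] BP'] ->.
  rewrite (partitionD1 pP' BP'); apply/forall_inP => C; rewrite !inE => /andP[_].
  by move/forall_inP: dP'; apply.
have BP := BnP _ Pm; move: Pm; rewrite inE => /andP[pP dP].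
exists (B |: P); last by rewrite setU1K.
rewrite !inE eqxx andbT; apply/andP; split.
  have dBA : [disjoint B & A :\: B] by rewrite disjoint_sym disjoints_subset setDE subsetIr.
  by rewrite -[A in partition _ A](setID A B) (setIidPr BA) partitionU1.
apply/forall_inP => C; rewrite !inE => /orP[/eqP ->|].
  by apply/existsP; exists t; apply/existsP; exists t'; rewrite tt' eqxx.
by move/forall_inP: dP; apply.
Qed.

Lemma card_matchings A t : t \in A ->
  #|matchings A| = (\sum_(t' in A | e t t') #|matchings (A :\: [set t; t'])|)%N.
Proof.
(* [f P] is the partner of [t] in [P]; by [ft] the default [t] never occurs. *)
move=> tA; pose f P := odflt t [pick t' | e t t' && ([set t; t'] \in P)].
have uniq_nbr P u v : P \in matchings A -> e t u -> [set t; u] \in P ->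
    [set t; v] \in P -> u = v.
  rewrite inE => /andP[pP _] tu uP vP; apply: contraTeq tu => neq_uv.
  have tp := partition_trivIset pP.
  have := def_pblock tp uP (set21 _ _); rewrite (def_pblock tp vP (set21 _ _)).
  by move/setP/(_ u); rewrite !inE eqxx orbT (negPf neq_uv) orbF => /eqP ->; rewrite eirr.
have ft P : P \in matchings A -> [/\ f P \in A, e t (f P) & [set t; f P] \in P].
  move=> Pm; move: (Pm); rewrite inE => /andP[pP dP].
  have tP : t \in cover P by rewrite (cover_partition pP).
  have [t' tt' Bt'] := dominosP dP (pblock_mem tP) (etrans (mem_pblock _ _) tP).
  have BP : [set t; t'] \in P by rewrite -Bt' pblock_mem.
  rewrite /f; case: pickP => [u /andP[tu uP]|/(_ t')]; last by rewrite tt' BP.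
  split=> //; apply: (subsetP (partitionS pP uP)); exact: set22.
rewrite -sum1_card (partition_big f (fun t' => (t' \in A) && e t t')) /=; last first.
  by move=> P /ft[-> ->].
apply: eq_bigr => t' /andP[t'A tt']; rewrite sum1_card -card_matchings_block //.
apply: eq_card => P; rewrite !inE -!topredE /=.
have [Pm|] := boolP (P \in matchings A); last by rewrite inE => /negPf ->.
move: (Pm); rewrite inE => ->; have [_ tf fP] := ft P Pm.
by apply/eqP/idP => [<-//|t'P]; apply: uniq_nbr fP t'P.
Qed.

End Matchings.

(** Both counts obey the expansion of [card_matchings] along a vertex, so induction on the size of
    [A] suffices. As [f] need not be onto, this also relates a region to a larger one containing
    it. *)
Lemma card_matchings_imset (T T' : finType) (e : rel T) (e' : rel T') (f : T -> T') :
  symmetric e -> irreflexive e -> symmetric e' -> irreflexive e' ->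
  injective f -> (forall x y, e' (f x) (f y) = e x y) ->
  forall A : {set T}, #|matchings e' (f @: A)| = #|matchings e A|.
Proof.
move=> es ei es' ei' fI fe A.
have [n] := ubnP #|A|; elim: n A => // n IHn A leAn.
have [->|/set0Pn[t tA]] := eqVneq A set0; first by rewrite imset0 !matchings0.
rewrite (card_matchings es ei tA) (card_matchings es' ei' (imset_f f tA)).
rewrite big_imset_cond /=; last by move=> ? ? _ _ /fI.
apply: eq_big => [t'|t' /andP[t'A tt']]; first by rewrite fe.
rewrite -IHn.
  congr (#|matchings _ _|); apply/setP => y.
  apply/setDP/imsetP => [[/imsetP[x xA ->]]|[x]]; rewrite !inE ?(inj_eq fI).
    by move=> nx; exists x; rewrite // !inE nx.
  by move=> /andP[nx xA] ->; rewrite imset_f // !(inj_eq fI).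
rewrite -ltnS; apply: leq_trans leAn; rewrite ltnS; apply: proper_card.
by apply/properP; split; [exact: subsetDl | exists t; rewrite // !inE eqxx].
Qed.

(** * Adjacency of unit triangles and recursion for the number of tilings *)

Definition nbrs (t : triangle) : seq triangle :=
  let: (x, y, up) := t in
  if up then [:: (x, y, false); (x - 1, y, false); (x, y - 1, false)]
  else [:: (x, y, true); (x + 1, y, true); (x, y + 1, true)].

Lemma vertices_shift x y u :
  vertices (x, y, u) = [seq (p.1 + x, p.2 + y) | p <- vertices (0, 0, u)].
Proof. by case: u; rewrite /= !add0r ![1 + _]addrC. Qed.

Lemma share_edge_shift x y u x' y' u' :
  share_edge (x, y, u) (x', y', u') = share_edge (0, 0, u) (x' - x, y' - y, u').
Proof.
rewrite /share_edge (vertices_shift x') (vertices_shift (x' - x)) !count_map.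
congr (_ == _); apply: eq_count => -[p q].
rewrite (vertices_shift x) !inE /= !addrA.
rewrite -[in RHS](mem_map (f := fun p => (p.1 + x, p.2 + y))).
  by rewrite /= !subrK.
by move=> [a b] [a' b'] [/addIr -> /addIr ->].
Qed.

(** After a translation the first triangle sits at the origin. Common vertices then require offsets
    in {-1, 0, 1}, which leaves finitely many cases to compute; for larger offsets every comparison
    of coordinates fails. *)
Lemma share_edgeE t t' : share_edge t t' = (t' \in nbrs t).
Proof.
case: t t' => [[x y] u] [[x' y'] u']; rewrite share_edge_shift.
have -> : ((x', y', u') \in nbrs (x, y, u))
        = ((x' - x, y' - y, u') \in nbrs (0, 0, u)).
  by case: u; rewrite !inE !xpair_eqE !subr_eq ?add0r ![_ + x]addrC ![_ + y]addrC ?addr0.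
move: (x' - x) (y' - y) => {x y} {}x {}y.
have near (a : int) : [\/ a = - 1, a = 0, a = 1 | (a < - 1) || (1 < a)].
  have [->|] := eqVneq a (- 1); first by constructor 1.
  have [->|] := eqVneq a 0; first by constructor 2.
  have [->|] := eqVneq a 1; first by constructor 3.
  by move=> *; constructor 4; lia.
have far (a : int) : (a < - 1) || (1 < a) ->
    ((a == 0) = false) * ((a == 1) = false) * ((a == -1) = false)
    * ((a + 1 == 0) = false) * ((a + 1 == 1) = false).
  by move=> ha; do !split; lia.
case: (near x) => hx; case: (near y) => hy; case: u; case: u';
  rewrite /share_edge /= !inE !xpair_eqE ?hx ?hy ?(far _ hx) ?(far _ hy) //.
Qed.

Lemma share_edge_sym : symmetric share_edge.
Proof.
case=> [[x y] [|]] [[x' y'] [|]];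
  rewrite !share_edgeE /= !inE !xpair_eqE /= ?andbT ?andbF ?orbF /=; lia.
Qed.

Lemma share_edge_irr : irreflexive share_edge.
Proof.
case=> [[x y] [|]];
  rewrite !share_edgeE /= !inE !xpair_eqE /= ?andbT ?andbF ?orbF /=; lia.
Qed.

Definition sub_edge (R : {fset triangle}) : rel R :=
  fun t t' => share_edge (val t) (val t').

Lemma M_matchings (R : {fset triangle}) : M R = #|matchings (@sub_edge R) setT|.
Proof. by []. Qed.

Local Open Scope fset_scope.
Local Open Scope ring_scope.

Lemma M_imfset (f : triangle -> triangle) (A : {fset triangle}) : injective f ->
  (forall t t', share_edge (f t) (f t') = share_edge t t') -> M (f @` A) = M A.
Proof.
move=> fI fe; rewrite !M_matchings.
have fA (t : A) : f (val t) \in f @` A by rewrite in_imfset //; exact: valP.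
rewrite -(card_matchings_imset (e := @sub_edge A) (e' := @sub_edge (f @` A))
            (f := fun t : A => [` fA t])).
- congr (#|matchings _ _|); apply/setP => t; rewrite inE; symmetry; apply/imsetP.
  have /imfsetP[/= u uA ut] := valP t; exists [` uA]; rewrite ?inE //.
  exact: val_inj.
- by move=> t t'; rewrite /sub_edge share_edge_sym.
- by move=> t; rewrite /sub_edge share_edge_irr.
- by move=> t t'; rewrite /sub_edge share_edge_sym.
- by move=> t; rewrite /sub_edge share_edge_irr.
- by move=> t t' /(congr1 val) /= /fI /val_inj.
- by move=> t t'; rewrite /sub_edge /= fe.
Qed.

(** [M A] lives in a type depending on [A]; this moves the counts of all subregions into the one
    type given by [R], where [card_matchings] applies. *)
Lemma M_sub (A R : {fset triangle}) : A `<=` R ->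
  M A = #|matchings (@sub_edge R) [set t : R | val t \in A]|.
Proof.
move=> sAR; rewrite M_matchings.
rewrite -(card_matchings_imset (e' := @sub_edge R) (f := fincl sAR)).
- congr (#|matchings _ _|); apply/setP => t; rewrite inE;
    apply/imsetP/idP => [[u _ ->]|tA].
    by rewrite /= (valP u).
  by exists [` tA]; rewrite ?inE //; apply: val_inj.
- by move=> t t'; rewrite /sub_edge share_edge_sym.
- by move=> t; rewrite /sub_edge share_edge_irr.
- by move=> t t'; rewrite /sub_edge share_edge_sym.
- by move=> t; rewrite /sub_edge share_edge_irr.
- exact: fincl_inj.
- by move=> t t'.
Qed.

Lemma M_fset0 : M fset0 = 1%N.
Proof.
rewrite M_matchings (_ : setT = set0) ?matchings0 //.
by apply/setP => t; have := valP t; rewrite in_fset0.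
Qed.

Lemma nbrs_uniq t : uniq (nbrs t).
Proof.
case: t => [[x y] [|]] /=; rewrite !inE !xpair_eqE /= ?andbT; lia.
Qed.

Lemma M_expand (A : {fset triangle}) t : t \in A ->
  M A = (\sum_(t' <- nbrs t | t' \in A) M (A `\ t `\ t'))%N.
Proof.
move=> tA; rewrite M_matchings (@card_matchings _ (@sub_edge A) _ _ _ [` tA]) ?inE //;
  first last.
- by move=> u; rewrite /sub_edge share_edge_irr.
- by move=> u v; rewrite /sub_edge share_edge_sym.
transitivity (\sum_(t' : A | share_edge t (val t')) M (A `\ t `\ val t'))%N.
  apply: eq_big => [t'|t' _]; rewrite ?inE //.
  rewrite (@M_sub _ A); last by apply/fsubsetP => u; rewrite !inE => /and3P[].
  by congr (#|matchings _ _|); apply/setP => u;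
    rewrite !inE -!val_eqE /= (valP u) !andbT negb_or andbC.
rewrite -(big_seq_fsetE _ _ (fun t' => share_edge t t') (fun t' => M (A `\ t `\ t'))).
rewrite -big_filter -[in RHS]big_filter; apply: perm_big; apply: uniq_perm.
- by rewrite filter_uniq ?fset_uniq.
- by rewrite filter_uniq ?nbrs_uniq.
by move=> u; rewrite !mem_filter share_edgeE andbC.
Qed.

(** * Forced lozenges and cutting along a horizontal line *)

Lemma M_forced1 (A : {fset triangle}) t t' : t \in A -> t' \in A -> t' \in nbrs t ->
  {in nbrs t, forall u, u \in A -> u = t'} -> M A = M (A `\ t `\ t').
Proof.
move=> tA t'A t'n only; rewrite (M_expand tA) -big_filter.
rewrite (_ : filter _ _ = [:: t']) ?big_seq1 //.
apply: perm_small_eq => //; apply: uniq_perm => //;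
  first by rewrite filter_uniq ?nbrs_uniq.
move=> u; rewrite mem_filter inE; apply/andP/eqP => [[uA un]|-> //].
exact: only.
Qed.

(* The cells of [D] carry the vertical lozenges formed by the down-pointing
   triangle of the cell and the up-pointing triangle above it. *)
Definition covered (D : pred (int * int)) (t : triangle) : bool :=
  let: (x, y, up) := t in if up then D (x, y - 1) else D (x, y).

(* Going through the cells of [D] from bottom to top, each down-pointing
   triangle has lost its two other neighbours when it is reached. *)
Lemma M_forced (D : pred (int * int)) (A A' : {fset triangle}) :
  (forall x y, D (x, y) -> ((x, y, false) \in A) && ((x, y + 1, true) \in A)) ->
  (forall x y, D (x, y) -> (x, y, true) \in A -> D (x, y - 1)) ->
  (forall x y, D (x, y) -> (x + 1, y, true) \in A -> D (x + 1, y - 1)) ->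
  (forall t, (t \in A') = (t \in A) && ~~ covered D t) -> M A = M A'.
Proof.
have [n] := ubnP #|` A|; elim: n D A => // n IHn D A; rewrite ltnS => leAn DA Dl Dr A'E.
pose S := [pred t : A | let: (x, y, u) := val t in ~~ u && D (x, y)].
case: (pickP S) => [t0 St0|S0]; last first.
  suff -> : A' = A by [].
  apply/fsetP => t; rewrite A'E andb_idr // => tA; apply/negP.
  have DF x y : ~~ D (x, y).
    by apply/negP => Dxy; case/andP: (DA _ _ Dxy) => dA _; have := S0 [` dA];
      rewrite /= Dxy.
  by case: t {tA} => [[x y] []] /=; apply/negP.
have := Order.TotalTheory.arg_minP (fun t : A => (val t).1.2) St0.
case=> -[[[x y] u] tA] /=; rewrite /= in x y u tA *; move=> /andP[/negbTE u0 Dxy] ymin;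
  rewrite {}u0 in tA *.
have {}ymin x' y' : D (x', y') -> y <= y'.
  move=> D'; case/andP: (DA _ _ D') => dA _; have := ymin [` dA] => /=; exact.
have [_ uA] := andP (DA _ _ Dxy).
rewrite (@M_forced1 A (x, y, false) (x, y + 1, true)) //; first last.
- move=> [[x' y'] u'] /=; rewrite !inE !xpair_eqE.
  move=> /or3P[] /andP[/andP[/eqP -> /eqP ->] /eqP ->] // inA.
    by have := ymin _ _ (Dl _ _ Dxy inA); lia.
  by have := ymin _ _ (Dr _ _ Dxy inA); lia.
- by rewrite !inE eqxx !orbT.
have uA1 : (x, y + 1, true) \in A `\ (x, y, false) by rewrite !inE uA xpair_eqE andbF.
apply: (IHn [pred p | D p && (p != (x, y))]).
- by move: leAn; rewrite (cardfsD1 (x, y, false)) tA (cardfsD1 (x, y + 1, true)) uA1;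
    set X := #|` _|; rewrite !add1n => /ltnW.
- move=> x' y' /andP[D' ne]; have /andP[] := DA _ _ D'; rewrite !inE => -> ->.
  by move: ne; rewrite !xpair_eqE /= ?(andbT, andbF); lia.
- move=> x' y' /andP[D' ne]; rewrite !inE !xpair_eqE => /and3P[n1 _ inA].
  move: n1; rewrite /= (Dl _ _ D' inA) andbT /=; lia.
- move=> x' y' /andP[D' ne]; rewrite !inE !xpair_eqE => /and3P[n1 _ inA].
  by move: n1; rewrite /= (Dr _ _ D' inA) andbT /=; lia.
move=> [[x' y'] [|]]; rewrite A'E !inE !xpair_eqE /= ?andbT ?andbF /= ?andbT.
  by rewrite -subr_eq -xpair_eqE; case: eqP => [->|_]; rewrite ?Dxy ?andbF ?andbT.
by rewrite -xpair_eqE; case: eqP => [->|_]; rewrite ?Dxy ?andbF ?andbT.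
Qed.

(** * Splitting a tiling by the lozenges that cross a horizontal line *)

Section Cut.
Variables (N : nat) (x0 c : int).
Implicit Types (A B : {fset triangle}) (K : {set 'I_N}).

(** [below k] and [above k] are the two halves of the lozenge that crosses the line y = c at the
    unit segment starting at x0 + k. *)
Definition below (k : 'I_N) : triangle := (x0 + k%:Z, c - 1, false).
Definition above (k : 'I_N) : triangle := (x0 + k%:Z, c, true).

Lemma below_inj : injective below.
Proof. by move=> k k' [/addrI [] /val_inj]. Qed.

Lemma above_inj : injective above.
Proof. by move=> k k' [/addrI [] /val_inj]. Qed.

Definition cut_below A K := A `\` [fset below k | k in K].
Definition cut_above B K := B `\` [fset above k | k in K].
Definition crossing A B K := [forall k in K, (below k \in A) && (above k \in B)].
Definition cut_sum A B :=
  (\sum_(K | crossing A B K) M (cut_below A K) * M (cut_above B K))%N.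

Definition separated A B :=
  [/\ forall t, t \in A -> t.1.2 < c, forall t, t \in B -> c <= t.1.2 &
      forall x, (x, c - 1, false) \in A -> exists k : 'I_N, x = x0 + k%:Z].

Lemma below_imfset k K : (below k \in [fset below i | i in K]) = (k \in K).
Proof.
by apply/imfsetP/idP => [[i /= iK /below_inj ->]|kK] //; exists k.
Qed.

Lemma above_imfset k K : (above k \in [fset above i | i in K]) = (k \in K).
Proof.
by apply/imfsetP/idP => [[i /= iK /above_inj ->]|kK] //; exists k.
Qed.

(** This is the expansion of [M_expand] for the union of [A] and [B] along a triangle of [A],
    carried out on the cut sum. Either [t] is matched within [A], and the factor of the lower part
    is expanded, or [t] is the lower half of a crossing lozenge. *)
Lemma cut_sum_expand A B t : separated A B -> t \in A ->
  cut_sum A B = (\sum_(t' <- nbrs t | t' \in A) cut_sum (A `\ t `\ t') B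
                 + \sum_(t' <- nbrs t | t' \in B) cut_sum (A `\ t) (B `\ t'))%N.
Proof.
move=> [Ac Bc AN] tA; rewrite /cut_sum.
pose cr K := t \in [fset below k | k in K].
rewrite (bigID cr) /= addnC; congr addn.
  transitivity (\sum_(K | crossing A B K && ~~ cr K)
     \sum_(t' <- nbrs t | t' \in cut_below A K)
        M (cut_below A K `\ t `\ t') * M (cut_above B K))%N.
    apply: eq_bigr => K /andP[_ tK]; rewrite -big_distrl -M_expand //.
    by rewrite inE tA andbT.
  rewrite (exchange_big_dep (fun t' => t' \in A)) /=; last first.
    by move=> K t' _; rewrite inE => /andP[].
  apply: eq_bigr => t' t'A; apply: eq_big => [K|K _]; last first.
    congr (M _ * _)%N; apply/fsetP => u; rewrite !inE.
    by do !case: (_ \in _); rewrite ?andbT ?andbF.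
  rewrite !inE t'A andbT -andbA;
    apply/and3P/forall_inP => [[/forall_inP ok tK t'K] k kK|ok].
    have /andP[bA ->] := ok k kK; rewrite !inE bA !andbT.
    apply/andP; split.
      by apply: contraNneq t'K => <-; rewrite below_imfset.
    by apply: contraNneq tK => tk; rewrite /cr -tk below_imfset.
  split; first by apply/forall_inP => k /ok; rewrite !inE => /andP[/and3P[_ _ ->] ->].
    by apply/negP => /imfsetP[k /= /ok];
      rewrite !inE => /andP[/and3P[_ /eqP nk _] _] /esym.
  by apply/negP => /imfsetP[k /= /ok]; rewrite !inE => /andP[/and3P[/eqP nk _ _] _] /esym.
have [/existsP[k0 /eqP tk0]|/existsPn tN] := boolP [exists k : 'I_N, t == below k];
  last first.
  (* If [t] is not one of the [below k], no crossing lozenge contains it and it has no neighbour in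
     [B]: both sides are empty sums. *)
  rewrite big_pred0 => [|K]; last first.
    apply/negP => /andP[_ /imfsetP[k /= _ tk]]; have := tN k; by rewrite tk eqxx.
  rewrite big_seq_cond big_pred0 // => t'; apply/negP => /andP[nt' /Bc t'c].
  have := Ac _ tA; case: t tA tN nt' {cr} => [[x y] [|]] /= tA tN;
    rewrite !inE => /or3P[] /eqP t'E; rewrite t'E /= in t'c => yc; try lia.
  have yE : y = c - 1 by lia.
  rewrite yE in tA; have [k xk] := AN _ tA.
  by have := tN k; rewrite /below xk yE eqxx.
have nbrB t' : t' \in nbrs t -> t' \in B -> t' = above k0.
  rewrite tk0 /= !inE => /or3P[] /eqP -> /Bc /=; try lia.
  by move=> _; rewrite subrK.
have [kB|kB] := boolP (above k0 \in B); last first.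
  rewrite big_pred0 => [|K]; last first.
    apply/negP => /andP[/forall_inP ok]; rewrite /cr tk0 below_imfset => /ok.
    by rewrite (negPf kB) andbF.
  rewrite big_seq_cond big_pred0 // => t'; apply/negP => /andP[nt' t'B].
  by rewrite -(nbrB t') ?t'B in kB.
rewrite -[in RHS]big_filter (_ : filter _ _ = [:: above k0]) ?big_seq1; last first.
  apply: perm_small_eq => //; apply: uniq_perm => //;
    first by rewrite filter_uniq ?nbrs_uniq.
  move=> u; rewrite mem_filter inE; apply/andP/eqP => [[uA un]|-> //].
    exact: nbrB.
  by rewrite tk0 /= !inE subrK eqxx !orbT.
(* A set of crossings through [t] is [k0] together with a set of crossings of what remains once [t]
   and its upper partner are removed. *)
rewrite (reindex_onto (fun K => k0 |: K) (fun K => K :\ k0)) /=; last first.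
  by move=> K /andP[_]; rewrite /cr tk0 below_imfset => /setD1K.
apply: eq_big => [K|K].
  rewrite /cr tk0 below_imfset setU11 andbT.
  have -> : ((k0 |: K) :\ k0 == K) = (k0 \notin K).
    by apply/eqP/idP => [<-|/setU1K //]; rewrite !inE eqxx.
  apply/andP/forall_inP => [[/forall_inP ok kK] k kK'|ok].
    have /andP[] := ok k (setU1r _ kK'); rewrite !inE => -> ->.
    rewrite (inj_eq below_inj) (inj_eq above_inj) !andbT.
    by have -> : k != k0 by apply: contraNneq kK => <-.
  split; last by apply/negP => /ok; rewrite !inE eqxx.
  apply/forall_inP => k; rewrite !inE => /orP[/eqP ->|/ok]; first by rewrite -tk0 tA.
  by rewrite !inE => /andP[/andP[_ ->] /andP[_ ->]].
move=> _; congr (M _ * M _)%N; apply/fsetP => u; rewrite !inE.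
  rewrite andbA -negb_or orbC; congr (~~ _ && _).
  apply/imfsetP/orP => [[k /=]|].
    rewrite !inE => /orP[/eqP -> ->|kK ->]; first by left; rewrite tk0.
    by right; rewrite below_imfset.
  case=> [/eqP ->|/imfsetP[k /= kK ->]]; first by exists k0; rewrite ?setU11.
  by exists k; rewrite // setU1r.
rewrite andbA -negb_or orbC; congr (~~ _ && _).
apply/imfsetP/orP => [[k /=]|].
  rewrite !inE => /orP[/eqP -> ->|kK ->]; first by left.
  by right; rewrite above_imfset.
case=> [/eqP ->|/imfsetP[k /= kK ->]]; first by exists k0; rewrite ?setU11.
by exists k; rewrite // setU1r.
Qed.

Lemma separatedW A B A' B' : A' `<=` A -> B' `<=` B -> separated A B -> separated A' B'.
Proof.
move=> /fsubsetP sA /fsubsetP sB [Ac Bc AN].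
by split=> [t /sA /Ac|t /sB /Bc|x /sA /AN].
Qed.

(** Both sides obey the same recursion in [A]; once [A] is empty, only the empty set of crossings is
    left. *)
Lemma M_cut A B : separated A B -> M (A `|` B) = cut_sum A B.
Proof.
have [n] := ubnP #|` A|; elim: n A B => // n IHn A B; rewrite ltnS => leAn sAB.
have [A0|[t tA]] := fset_0Vmem A.
  rewrite A0 fset0U /cut_sum (big_pred1 set0) => [|K]; last first.
    apply/forall_inP/eqP => [ok|-> k]; last by rewrite inE.
    by apply/setP => k; rewrite inE; apply/negP => /ok; rewrite inE.
  rewrite /cut_below fset0D M_fset0 mul1n; congr M; apply/fsetP => u.
  rewrite inE; case: imfsetP => //= -[k /=]; by rewrite inE.
have tnB : t \notin B by case: sAB => Ac Bc _; apply/negP => /Bc; have := Ac t tA; lia.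
rewrite (cut_sum_expand sAB tA) (@M_expand _ t) ?inE ?tA //.
rewrite (bigID (fun t' => t' \in A)) /=; congr addn.
  apply: eq_big => [t'|t' /andP[_ t'A]]; first by rewrite inE; case: (_ \in A);
    rewrite ?andbT ?andbF.
  rewrite -IHn.
  - congr M; apply/fsetP => u; rewrite !inE.
    have [->|] := eqVneq u t; rewrite ?andbF /= ?(negPf tnB) //.
    have t'nB : t' \notin B by case: sAB => Ac Bc _; apply/negP => /Bc;
      have := Ac t' t'A; lia.
    by have [->|] //= := eqVneq u t'; rewrite (negPf t'nB).
  - by apply: leq_trans leAn; rewrite (cardfsD1 t A) tA ltnS fsubset_leq_card ?fsubD1set.
  - apply: separatedW sAB => //; apply/fsubsetP => u; by rewrite !inE => /and3P[].
apply: eq_big => [t'|t' /andP[t'AB t'A]].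
  rewrite inE; case: (boolP (t' \in A)) => t'A; rewrite ?andbT ?andbF //.
  by apply/esym/negP; case: sAB => Ac Bc _ /Bc; have := Ac t' t'A; lia.
rewrite -IHn.
- congr M; apply/fsetP => u; rewrite !inE.
  have [->|] := eqVneq u t; rewrite ?andbF /= ?(negPf tnB) ?andbF //.
  have [->|] //= := eqVneq u t'; by rewrite (negPf t'A).
- by apply: leq_trans leAn; rewrite [X in (_ < X)%N](cardfsD1 t A) tA.
- apply: separatedW sAB; apply/fsubsetP => u; by rewrite !inE => /andP[].
Qed.
End Cut.

(** * Dented trapezoids *)

(** The binomial coefficient of X over j as a polynomial, so that positions of any sign may be
    inserted and the Vandermonde determinant can be extracted. *)
Definition bin_poly (j : nat) : {poly rat} :=
  (j`!%:R)^-1 *: \prod_(m < j) ('X - m%:R%:P).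

Definition binv (x : int) (j : nat) : rat := (bin_poly j).[x%:~R].

(** By Pascal's rule this is minus the binomial coefficient of x over j - 1: a row of the
    determinant one size smaller, shifted by one column. *)
Definition dbinv (x : int) (j : nat) : rat := binv x j - binv (x + 1) j.

Lemma binvE x j : binv x j = (j`!%:R)^-1 * \prod_(m < j) (x%:~R - m%:R).
Proof.
rewrite /binv hornerZ horner_prod; congr (_ * _).
by apply: eq_bigr => m _; rewrite !hornerE.
Qed.

Lemma binv0 x : binv x 0 = 1.
Proof. by rewrite binvE big_ord0 fact0 invr1 mulr1. Qed.

Lemma dbinv0 x : dbinv x 0 = 0.
Proof. by rewrite /dbinv !binv0 subrr. Qed.

Lemma dbinvS x j : dbinv x j.+1 = - binv x j.
Proof.
rewrite /dbinv !binvE -mulrBr factS natrM.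
rewrite [X in _ - X]big_ord_recl big_ord_recr /= subr0.
have -> : \prod_(i < j) ((x + 1)%:~R - (bump 0 i)%:R)
          = \prod_(i < j) (x%:~R - i%:R) :> rat.
  by apply: eq_bigr => i _; rewrite /bump add1n -natr1 intrD opprD addrACA subrr addr0.
move: (\prod_(i < j) _) => p; rewrite intrD -natr1.
have f0 : (j`!)%:R != 0 :> rat by rewrite pnatr_eq0 -lt0n fact_gt0.
have j0 : j%:R + 1 != 0 :> rat by rewrite natr1 pnatr_eq0.
by field; rewrite j0 f0.
Qed.

(** The value 0 for a wrong number of rows is the right one: a dented trapezoid has no tilings
    unless it has as many dents as its height. *)
Definition row_det (n : nat) (rows : seq (nat -> rat)) : rat :=
  if size rows == n
  then \det (\matrix_(i < n, j < n) nth (fun=> 0) rows i j) else 0.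

Lemma row_detD n r1 r2 f g k : (forall j, f j = g j + k j) ->
  row_det n (r1 ++ f :: r2) = row_det n (r1 ++ g :: r2) + row_det n (r1 ++ k :: r2).
Proof.
move=> fE; rewrite /row_det !size_cat /=; case: eqP => [sz|_]; last by rewrite addr0.
have lt : (size r1 < n)%N by rewrite -sz addnS ltnS leq_addr.
rewrite -[X in _ = X + _]mul1r -[X in _ = _ + X]mul1r.
have nthE (u : nat -> rat) (i : 'I_n.-1) : nth (fun=> 0) (r1 ++ u :: r2) (lift (Ordinal lt) i)
    = nth (fun=> 0) (r1 ++ f :: r2) (lift (Ordinal lt) i).
  rewrite !nth_cat /=; case: ltnP => // le.
  case E: (bump (size r1) i - size r1)%N => [|m] //=.
  by move: E le; rewrite /bump; move: (size r1) (nat_of_ord i) => p q; case: leqP => /=;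
    lia.
apply: (@determinant_multilinear _ _ _ _ _ (Ordinal lt)).
- by apply/rowP => j; rewrite !mxE /= !nth_cat ltnn subnn /= fE !mul1r.
- by apply/matrixP => i j; rewrite !mxE nthE.
- by apply/matrixP => i j; rewrite !mxE nthE.
Qed.

Lemma row_det_eq_rows n r1 r2 f : row_det n (r1 ++ f :: f :: r2) = 0.
Proof.
rewrite /row_det !size_cat /=; case: eqP => // sz.
have lt1 : (size r1 < n)%N by rewrite -sz addnS ltnS leq_addr.
have lt2 : ((size r1).+1 < n)%N by rewrite -sz !addnS !ltnS leq_addr.
apply: (@determinant_alternate _ _ _ (Ordinal lt1) (Ordinal lt2)).
  by rewrite -val_eqE /= neq_ltn ltnSn.
move=> j; rewrite !mxE /= !nth_cat ltnn subnn ltnNge leqnSn /=.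
by rewrite subSnn.
Qed.

Lemma row_det_dbinv n T : row_det n.+1 (map dbinv T) = 0.
Proof.
rewrite /row_det size_map; case: eqP => // sz.
rewrite (expand_det_col _ ord0) big1 // => i _; rewrite !mxE.
by rewrite (nth_map 0) ?sz // dbinv0 mul0r.
Qed.

(** Column 0 vanishes except for the entry 1 in the last row. The sign of its cofactor cancels
    against the n signs in [dbinvS]. *)
Lemma row_det_last n T x :
  row_det n.+1 (map dbinv T ++ [:: binv x]) = row_det n (map binv T).
Proof.
rewrite /row_det size_cat !size_map addn1 eqSS; case: eqP => // sz.
rewrite (expand_det_col _ ord0) (bigD1 ord_max) //= big1 ?addr0 => [|i ni]; last first.
  rewrite !mxE nth_cat size_map sz.
  have -> : (i < n)%N by have := ltn_ord i; move: ni; rewrite -val_eqE /=; lia.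
  rewrite (nth_map 0) ?sz ?dbinv0 ?mul0r //.
  by have := ltn_ord i; move: ni; rewrite -val_eqE /=; lia.
rewrite !mxE nth_cat size_map sz ltnn subnn /= binv0 mul1r /cofactor /= addn0.
rewrite -detZ; congr (\det _); apply/matrixP => i j; rewrite !mxE /=.
have -> : bump n i = i by rewrite /bump leqNgt ltn_ord.
rewrite nth_cat size_map sz ltn_ord /bump leq0n.
by rewrite !(nth_map 0) ?sz // add1n dbinvS mulN1r opprK.
Qed.

Lemma size_bin_prod j : size (\prod_(m < j) ('X - m%:R%:P) : {poly rat}) = j.+1.
Proof. by rewrite size_prod_XsubC /index_enum -enumT size_enum_ord. Qed.

Lemma coef_bin_poly_trig i j : (j < i)%N -> (bin_poly j)`_i = 0.
Proof. by move=> ji; rewrite coefZ nth_default ?mulr0 // size_bin_prod. Qed.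

Lemma coef_bin_poly_diag j : (bin_poly j)`_j = (j`!%:R)^-1.
Proof.
rewrite coefZ; have := monic_prod_XsubC (index_enum 'I_j) predT (fun m => m%:R : rat).
by move/monicP; rewrite lead_coefE size_bin_prod => ->; rewrite mulr1.
Qed.

(** The matrix is the transpose of the product of a triangular coefficient matrix, with diagonal
    entries 1/j!, and a Vandermonde matrix. *)
Lemma row_det_binv s : row_det (size s) (map binv s) =
  (\prod_(j < size s) \prod_(i < j) ((nth 0 s j)%:~R - (nth 0 s i)%:~R))
  / (hfact (size s))%:R.
Proof.
set n := size s; rewrite /row_det size_map eqxx.
pose a := \row_(i < n) (nth 0 s i)%:~R : 'rV[rat]_n.
pose C := \matrix_(i < n, j < n) (bin_poly i)`_j.
have -> : \matrix_(i < n, j < n) nth (fun=> 0) (map binv s) i j = (C *m Vandermonde n a)^T.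
  apply/matrixP => i j; rewrite !mxE (nth_map 0) // /binv.
  rewrite (@horner_coef_wide _ n); last first.
    by apply: leq_trans (size_scale_leq _ _) _; rewrite size_bin_prod.
  by apply: eq_bigr => k _; rewrite !mxE.
rewrite det_tr det_mulmx det_Vandermonde mulrC; congr (_ * _).
  rewrite (exchange_big_dep predT) //=; apply: eq_bigr => j _.
  rewrite (big_ord_widen n (fun i => (nth 0 s j)%:~R - (nth 0 s i)%:~R));
    last exact: ltnW.
  by apply: eq_bigr => i _; rewrite !mxE.
rewrite det_trig; last first.
  apply/is_trig_mxP => i j ij; rewrite !mxE coef_bin_poly_trig //.
rewrite /hfact natr_prod -prodfV; apply: eq_bigr => i _.
by rewrite !mxE coef_bin_poly_diag.
Qed.

(** * Sweeping the bottom row of a dented trapezoid *)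

Ltac blia := repeat match goal with |- context [in_mem ?a (mem ?S)] =>
  move: (in_mem a (mem S)) => ? end; lia.

(** Each row of this trapezoid has one more up-pointing than down-pointing triangle, so a tiling
    needs exactly [h] up-pointing dents. *)
Definition trap (nw ne y : int) (h : nat) (t : triangle) : bool :=
  let: (a, b, u) := t in
  [&& y <= b, b < y + h%:Z, nw <= a & a + b + (if u then 1 else 2) <= ne].

Definition dent (S : seq int) (y : int) (t : triangle) : bool :=
  let: (a, b, u) := t in [&& u, b == y & a \in S].

(* What remains of a trapezoid with dents [S] when the matching of the bottom
   row has been chosen from left to right up to abscissa [xu] for up-pointing
   and [xd] for down-pointing triangles, those at [T] being matched upwards. *)
Definition row_state (nw ne y : int) (h : nat) (xu xd : int) (T S : seq int)
    (t : triangle) : bool :=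
  let: (a, b, u) := t in
  (trap nw ne (y + 1) h t && ~~ dent T (y + 1) t)
  || [&& b == y, (if u then xu else xd) <= a,
         a + b + (if u then 1 else 2) <= ne & ~~ (u && (a \in S))].

Section RowSteps.
Variables (nw ne y : int) (h : nat) (x : int) (T S : seq int) (A : {fset triangle}).
Local Notation state := (row_state nw ne y h).

Lemma row_state_pair : (forall t, (t \in A) = state x x T S t) ->
  forall t, (t \in A `\ (x, y, true) `\ (x, y, false)) = state (x + 1) (x + 1) T S t.
Proof.
move=> AE [[a b] [|]]; rewrite !inE !xpair_eqE AE /= ?andbT ?andbF /=;
  clear AE; blia.
Qed.

Lemma row_state_right : (forall t, (t \in A) = state (x + 1) x T S t) ->
  forall t, (t \in A `\ (x, y, false) `\ (x + 1, y, true))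
            = state (x + 1 + 1) (x + 1) T S t.
Proof.
move=> AE [[a b] [|]]; rewrite !inE !xpair_eqE AE /= ?andbT ?andbF /=;
  clear AE; blia.
Qed.

Lemma row_state_up : (forall t, (t \in A) = state (x + 1) x T S t) ->
  forall t, (t \in A `\ (x, y, false) `\ (x, y + 1, true))
            = state (x + 1) (x + 1) (rcons T x) S t.
Proof.
move=> AE [[a b] [|]];
  rewrite !inE !xpair_eqE AE /= ?andbT ?andbF /= ?mem_rcons ?inE; clear AE; blia.
Qed.

Lemma row_state_dent : {in S, forall s, x < s} ->
  forall t, state x x T (x :: S) t = state (x + 1) x T S t.
Proof.
by move=> xS [[a b] [|]] //; have := xS a; rewrite /= inE; clear xS; blia.
Qed.

End RowSteps.

Lemma sorted_rcons_lt (T : seq int) x :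
  sorted <%R T -> {in T, forall t, t < x} -> sorted <%R (rcons T x).
Proof.
rewrite !(sorted_pairwise lt_trans) pairwise_rcons => -> Tx.
by rewrite andbT; apply/allP.
Qed.

Section Row.
Variables (nw ne y : int) (h : nat).
Hypothesis trap_det : forall (S : seq int) (A : {fset triangle}),
  (forall t, (t \in A) = trap nw ne (y + 1) h t && ~~ dent S (y + 1) t) ->
  sorted <%R S -> {in S, forall s, nw <= s < ne - (y + 1)} -> (h = 0%N -> S = [::]) ->
  (M A)%:R = row_det h (map binv S).

(** [m] counts the down-pointing triangles of the row that are still to be matched. A dent in [S]
    contributes a row [binv]; a down-pointing triangle already matched upwards makes a dent in the
    next trapezoid and contributes a row [dbinv]. *)
Definition open_row (m : nat) := forall x T S (A : {fset triangle}),
  x + y + 1 + m%:Z = ne -> nw <= x ->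
  (forall t, (t \in A) = row_state nw ne y h x x T S t) ->
  sorted <%R T -> {in T, forall t, nw <= t < x} -> (h = 0%N -> T = [::]) ->
  sorted <%R S -> {in S, forall s, x <= s < ne - y} ->
  (M A)%:R = row_det h.+1 (map dbinv T ++ map binv S).

(** The up-pointing triangle at [x] is gone, whether as a dent or matched to its left, so the state
    carries the row [binv x] as if [x] were a dent. *)
Definition pending_row (m : nat) := forall x T S (A : {fset triangle}),
  x + y + 1 + m%:Z = ne -> nw <= x ->
  (forall t, (t \in A) = row_state nw ne y h (x + 1) x T S t) ->
  sorted <%R T -> {in T, forall t, nw <= t < x} -> (h = 0%N -> T = [::]) ->
  sorted <%R S -> {in S, forall s, x < s < ne - y} ->
  (M A)%:R = row_det h.+1 (map dbinv T ++ binv x :: map binv S).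

(** The row is used up: what remains is the next trapezoid with dents [T], and [row_det_last] lowers
    the size of the determinant accordingly. *)
Lemma pending_row0 : pending_row 0.
Proof.
move=> x T S A xm nx AE sT Tx hT sS Sx.
have -> : S = [::].
  by case: S Sx {AE sS} => // s S /(_ s (mem_head _ _)); lia.
rewrite row_det_last; apply: trap_det => // [[[a b] u]|t /Tx]; last by lia.
rewrite AE /= (_ : [&& b == y, _, _ & _] = false) ?orbF //.
by case: u; blia.
Qed.

(* The down-pointing triangle at [x] is matched to the right or upwards; in the
   determinant this is the identity [binv x = binv (x + 1) + dbinv x] in one row. *)
Lemma pending_rowS m : open_row m -> pending_row m -> pending_row m.+1.
Proof.
move=> openm pendm x T S A xm nx AE sT Tx hT sS Sx.
have xm1 : x + 1 + y + 1 + m%:Z = ne by clear -xm; lia.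
have nx1 : nw <= x + 1 by clear -nx; lia.
have xlT : x \notin T by apply/negP => /Tx; rewrite ltxx andbF.
have tA : (x, y, false) \in A by rewrite AE /=; clear -xm nx; blia.
have nA1 : (x, y, true) \in A = false by rewrite AE /=; clear -xm nx; blia.
have nA2 : (x + 1, y, true) \in A = (x + 1 \notin S) by rewrite AE /=; clear -xm nx; blia.
have nA3 : (x, y + 1, true) \in A = (h != 0)%N.
  by rewrite AE /= (negPf xlT); clear -xm nx; blia.
have Tx1 : {in T, forall t, nw <= t < x + 1} by move=> t /Tx; clear; lia.
rewrite (row_detD _ _ _ (f := binv x) (g := binv (x + 1)) (k := dbinv x)); last first.
  by move=> j; rewrite /dbinv addrC subrK.
pose F t' := M (A `\ (x, y, false) `\ t').
have right : (if x + 1 \notin S then F (x + 1, y, true) else 0)%:R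
     = row_det h.+1 (map dbinv T ++ binv (x + 1) :: map binv S).
  case: ifPn => [x1S|/negPn x1S].
    apply: pendm => //; first exact: row_state_right.
    move=> s sS'; have := Sx s sS'.
    have : s != x + 1 by apply: contraNneq x1S => <-.
    by clear; lia.
  (* If [x + 1] is a dent, the triangle cannot be matched to the right; on the other side the
     determinant has two equal rows. *)
  case: S x1S sS Sx {AE nA2} => // s S; rewrite inE /= => x1S sS Sx.
  have <- : x + 1 = s.
    apply/eqP; move: x1S; case: eqP => //= _ x1S.
    have := Sx s (mem_head _ _); have := order_path_min lt_trans sS.
    by move/allP/(_ _ x1S); clear; lia.
  by rewrite row_det_eq_rows.
have up : (if h != 0%N then F (x, y + 1, true) else 0)%:R
     = row_det h.+1 (map dbinv T ++ dbinv x :: map binv S).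
  case: ifPn => [h0|/negPn/eqP h0].
    rewrite -cat_rcons -map_rcons; apply: (openm (x + 1)) => //.
    - exact: row_state_up.
    - by apply: sorted_rcons_lt => // t /Tx /andP[].
    - by move=> t; rewrite mem_rcons inE => /predU1P[->|/Tx1 //]; rewrite nx ltrDl.
    - by move=> /eqP; rewrite (negPf h0).
    - by move=> s /Sx; clear; lia.
  (* With no row above, nothing can be matched upwards: the determinant of size 1 is either the
     entry [dbinv x 0 = 0] or has too many rows. *)
  rewrite h0 hT //=; case: S {AE nA2 sS Sx right} => [|s S].
    by rewrite (row_det_dbinv 0 [:: x]).
  by rewrite /row_det.
have -> : M A = (\sum_(t' <- nbrs (x, y, false) | t' \in A) F t')%N by exact: M_expand.
rewrite -right -up -natrD -big_filter /= nA1 nA2 nA3 {right up}; clearbody F.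
by case: (_ \notin S); case: (h != 0)%N; rewrite ?big_cons ?big_nil ?addn0 ?add0n.
Qed.

(** If [x] is a dent, it becomes the pending row. Otherwise the up-pointing triangle at [x] can only
    be matched with the down-pointing one of the same cell, and the sweep moves on by one cell. *)
Lemma open_row_pending m : pending_row m -> (m = 0%N \/ open_row m.-1) -> open_row m.
Proof.
move=> pendm openm x T S A xm nx AE sT Tx hT sS Sx.
have [xS|xS] := boolP (x \in S).
  case: S xS sS Sx AE => // s S xS sS Sx AE.
  have sx : s = x.
    apply/eqP; move: xS; rewrite inE eq_sym; case: eqP => //= _ xS.
    have := Sx s (mem_head _ _); have := order_path_min lt_trans sS.
    by move/allP/(_ _ xS); clear; lia.
  subst s.
  have xltS s : s \in S -> x < s by move/(allP (order_path_min lt_trans sS)).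
  apply: pendm => //.
  - by move=> t; rewrite AE row_state_dent.
  - exact: path_sorted sS.
  - by move=> s sS'; rewrite xltS //; have := Sx s;
      rewrite inE sS' orbT => /(_ isT) /andP[].
have tA : (x, y, true) \in A by rewrite AE /= (negPf xS); clear -xm nx; blia.
case: m => [|m] in pendm openm xm *.
  (* The free up-pointing triangle at the end of the row has no neighbour left, so there is no
     tiling; all rows being [dbinv], column 0 of the determinant vanishes as well. *)
  have -> : S = [::].
    case: S Sx xS {AE sS tA} => // s S /(_ s (mem_head _ _)) sx.
    by rewrite inE negb_or => /andP[]; clear -sx xm; lia.
  have nA1 : (x, y, false) \in A = false by rewrite AE /=; clear -xm nx; blia.
  have nA2 : (x - 1, y, false) \in A = false by rewrite AE /=; clear -xm nx; blia.
  have nA3 : (x, y - 1, false) \in A = false by rewrite AE /=; clear -xm nx; blia.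
  by rewrite (M_expand tA) /= -big_filter /= nA1 nA2 nA3 big_nil cats0 row_det_dbinv.
rewrite (M_forced1 tA (t' := (x, y, false))).
- case: openm => // openm; apply: (openm (x + 1)) => //.
  + by clear -xm; lia.
  + by clear -nx; lia.
  + exact: row_state_pair.
  + by move=> t /Tx; clear; lia.
  + move=> s sS'; have := Sx s sS'.
    have : s != x by apply: contraNneq xS => <-.
    by clear; lia.
- by rewrite AE /=; clear -xm nx; blia.
- by rewrite /= inE eqxx.
by move=> u; rewrite /= !inE => /or3P[] /eqP -> //; rewrite AE /=; clear -xm nx; blia.
Qed.

Lemma row_matchings m : open_row m /\ pending_row m.
Proof.
elim: m => [|m [openm pendm]].
  by split; [apply: open_row_pending; [exact: pending_row0|left] | exact: pending_row0].
have pendm1 := pending_rowS openm pendm.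
by split=> //; apply: open_row_pending => //; right.
Qed.

End Row.

(** Induction on the height: the whole trapezoid is an open row starting at [nw] with nothing
    matched upwards yet. *)
Lemma M_trap (nw ne y : int) (h : nat) (S : seq int) (A : {fset triangle}) :
  nw + y + h%:Z <= ne ->
  (forall t, (t \in A) = trap nw ne y h t && ~~ dent S y t) ->
  sorted <%R S -> {in S, forall s, nw <= s < ne - y} -> (h = 0%N -> S = [::]) ->
  (M A)%:R = row_det h (map binv S).
Proof.
elim: h y S A => [|h IHh] y S A le AE sS Sb hS.
  rewrite hS // (_ : A = fset0) ?M_fset0 ?/row_det /= ?det_mx00 //.
  by apply/fsetP => -[[a b] u]; rewrite AE /= inE; lia.
have det_h S' A' := IHh (y + 1) S' A' ltac:(clear -le; lia).
have [m mE] : exists m : nat, nw + y + 1 + m%:Z = ne.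
  by exists (absz (ne - (nw + y + 1))%R); lia.
have [openm _] := row_matchings det_h m.
apply: (openm nw [::] S) => //.
by move=> [[a b] [|]]; rewrite AE /= ?andbF /=; clear -mE; blia.
Qed.

(** * Vandermonde products *)

(** The absolute value makes [vdm] and [cross] insensitive to the order of their arguments, so that
    unions of positions can be treated as concatenations up to permutation. *)
Definition dist (x y : int) : rat := `|x%:~R - y%:~R|.

Fixpoint vdm (s : seq int) : rat :=
  if s is x :: s' then (\prod_(y <- s') dist x y) * vdm s' else 1.

Definition cross (s t : seq int) : rat := \prod_(x <- s) \prod_(y <- t) dist x y.

Lemma distC x y : dist x y = dist y x.
Proof. exact: distrC. Qed.

Lemma dist_shift d x y : dist (x + d) (y + d) = dist x y.
Proof. by rewrite /dist !intrD opprD addrACA subrr addr0. Qed.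

Lemma dist_opp x y : dist (- x - 1) (- y - 1) = dist x y.
Proof. by rewrite dist_shift /dist !intrN -opprD normrN. Qed.

Lemma dist_eq0 x y : (dist x y == 0) = (x == y).
Proof. by rewrite normr_eq0 subr_eq0 eqr_int. Qed.

Lemma cross_catl s1 s2 t : cross (s1 ++ s2) t = cross s1 t * cross s2 t.
Proof. by rewrite /cross big_cat. Qed.

Lemma cross_catr s t1 t2 : cross s (t1 ++ t2) = cross s t1 * cross s t2.
Proof. by rewrite /cross -big_split; apply: eq_bigr => x _; rewrite big_cat. Qed.

Lemma perm_crossr s t1 t2 : perm_eq t1 t2 -> cross s t1 = cross s t2.
Proof. by move=> t12; apply: eq_bigr => x _; apply: perm_big. Qed.

Lemma cross_shift d s t : cross (map (+%R^~ d) s) (map (+%R^~ d) t) = cross s t.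
Proof.
rewrite /cross big_map; apply: eq_bigr => x _; rewrite big_map.
by apply: eq_bigr => y _; rewrite dist_shift.
Qed.

Lemma vdm_cat s t : vdm (s ++ t) = vdm s * vdm t * cross s t.
Proof.
elim: s => [|x s IHs] /=; first by rewrite mul1r /cross big_nil mulr1.
by rewrite IHs big_cat /cross big_cons /=; ring.
Qed.

Lemma perm_vdm s t : perm_eq s t -> vdm s = vdm t.
Proof.
elim: s t => [|x s IHs] t st.
  by move: st; rewrite perm_sym => /perm_nilP ->.
have [t1 [t2 tE]] : exists t1 t2, t = t1 ++ x :: t2.
  have /splitPr[t1 t2] : x \in t by rewrite -(perm_mem st) mem_head.
  by exists t1, t2.
rewrite {}tE in st *.
have st' : perm_eq s (t1 ++ t2).
    by rewrite -(perm_cons x) (perm_trans st) //; apply/permP => a;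
      rewrite /= !count_cat /= addnCA.
rewrite /= (IHs _ st') !vdm_cat /= (perm_big _ st') big_cat /=.
rewrite /cross -[in RHS]cat1s.
rewrite (_ : \prod_(y <- t1) dist x y = \prod_(y <- t1) dist y x); last first.
  by apply: eq_bigr => y _; exact: distC.
rewrite (_ : \prod_(z <- t1) \prod_(y <- [:: x] ++ t2) dist z y =
   (\prod_(y <- t1) dist y x) * \prod_(z <- t1) \prod_(y <- t2) dist z y); first ring.
by rewrite -big_split; apply: eq_bigr => y _; rewrite big_cons.
Qed.

Lemma vdm_map f s : (forall x y, dist (f x) (f y) = dist x y) -> vdm (map f s) = vdm s.
Proof.
move=> fd; elim: s => //= x s ->; rewrite big_map; congr (_ * _).
by apply: eq_bigr => y _; rewrite fd.
Qed.

Lemma vdm_neq0 s : uniq s -> vdm s != 0.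
Proof.
elim: s => [//|x s IHs] /=.
move=> /andP[xs us]; rewrite mulf_neq0 ?IHs // prodf_seq_neq0.
by apply/allP => y ys /=; rewrite dist_eq0; apply: contraNneq xs => ->.
Qed.

Lemma vdm_sorted s : sorted <%R s ->
  \prod_(j < size s) \prod_(i < j) ((nth 0 s j)%:~R - (nth 0 s i)%:~R) = vdm s.
Proof.
elim/last_ind: s => [|s x IHs]; first by rewrite big_ord0.
rewrite (sorted_pairwise lt_trans) pairwise_rcons -(sorted_pairwise lt_trans).
move=> /andP[/allP sx ss].
rewrite size_rcons big_ord_recr /= -cats1 vdm_cat /= big_nil !mulr1.
congr (_ * _).
  rewrite -IHs //; apply: eq_bigr => j _; apply: eq_bigr => i _.
  by rewrite !nth_cat ltn_ord (ltn_trans (ltn_ord i) (ltn_ord j)).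
rewrite /cross (big_nth 0) big_mkord; apply: eq_bigr => i _.
rewrite big_seq1 !nth_cat ltn_ord ltnn subnn /= distC /dist ger0_norm //.
by rewrite subr_ge0 ler_int ltW // sx ?mem_nth.
Qed.

Lemma M_trap_vdm (nw ne y : int) (h : nat) (S : seq int) (A : {fset triangle}) :
  nw + y + h%:Z <= ne ->
  (forall t, (t \in A) = trap nw ne y h t && ~~ dent S y t) ->
  uniq S -> {in S, forall s, nw <= s < ne - y} -> (h = 0%N -> S = [::]) ->
  (M A)%:R = if size S == h then vdm S / (hfact h)%:R else 0.
Proof.
move=> le AE uS Sb hS; pose S' := sort <=%R S.
have pS : perm_eq S' S by rewrite perm_sort.
have sS' : sorted <%R S' by rewrite sort_lt_sorted.
rewrite (@M_trap nw ne y h S') //.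
- case: eqP => szS; last first.
    by rewrite /row_det size_map size_sort; move/eqP/negPf: szS => ->.
  rewrite -szS -(perm_size pS) row_det_binv (vdm_sorted sS').
  by rewrite (perm_vdm pS).
- by move=> [[a b] u]; rewrite AE /= (perm_mem pS).
- by move=> s; rewrite (perm_mem pS) => /Sb.
- by move=> h0; rewrite /S' hS.
Qed.

(** * Half regions with lobes along their base *)

Definition irange (l : int) (n : nat) : seq int := [seq l + k%:Z | k <- iota 0 n].

Lemma mem_irange l n x : (x \in irange l n) = (l <= x < l + n%:Z).
Proof.
apply/mapP/idP => [[k]|]; first by rewrite mem_iota => ? ->; lia.
by move=> lx; exists (absz (x - l)%R); rewrite ?mem_iota; lia.
Qed.

Lemma irange_uniq l n : uniq (irange l n).
Proof. by rewrite map_inj_uniq ?iota_uniq // => i j /addrI []. Qed.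

Lemma size_irange l n : size (irange l n) = n.
Proof. by rewrite size_map size_iota. Qed.

Lemma irangeD l m n : irange l (m + n) = irange l m ++ irange (l + m%:Z) n.
Proof.
rewrite /irange iotaD map_cat add0n; congr (_ ++ _).
rewrite -[in LHS](addn0 m) iotaDl -map_comp; apply: eq_map => k /=.
by rewrite PoszD addrA.
Qed.

Lemma irange_shift d l n : irange (l + d) n = map (+%R^~ d) (irange l n).
Proof. by rewrite -map_comp; apply: eq_map => k /=; rewrite addrAC. Qed.

Definition segs (L : seq (int * nat)) : seq int :=
  flatten [seq irange p.1 p.2 | p <- L].

Lemma mem_segs L x : (x \in segs L) = has (fun p => p.1 <= x < p.1 + p.2%:Z) L.
Proof.
apply/flattenP/hasP => [[s /mapP[p pL ->]]|[p pL xp]].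
  by rewrite mem_irange => xp; exists p.
exists (irange p.1 p.2); last by rewrite mem_irange.
exact: (map_f (fun p => irange p.1 p.2)).
Qed.

Definition up_lobe (y : int) (p : int * nat) (t : triangle) : bool :=
  let: (a, b, u) := t in
  [&& y <= b, p.1 <= a & a + b + (if u then 1 else 2) <= p.1 + p.2%:Z + y].

Lemma mem_box H a b u : bot H <= top H -> nw H <= se H ->
  ((a, b, u) \in box_triangles H) = (nw H <= a < se H) && (bot H <= b < top H).
Proof.
move=> tb nse; apply/allpairsP/idP => [[[[i j] v] /= [/allpairsP[[k l] /= []]]]|ab].
  by rewrite !mem_iota => kn ln [-> ->] _ [-> -> _]; lia.
exists ((a, b), u); split=> //=; last by case: u; rewrite !inE.
apply/allpairsP; exists (absz (a - nw H)%R, absz (b - bot H)%R).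
by split; rewrite /= ?mem_iota; [lia | lia | congr (_, _); lia].
Qed.

(** A lobe may be traded for dents along its base: once these dents are made, the rest of the lobe
    can only be filled by vertical lozenges, as [M_forced] shows. *)
Lemma M_half (nw ne y : int) (h : nat) (L : seq (int * nat)) (K : seq int)
    (A : {fset triangle}) :
  nw + y + h%:Z <= ne ->
  {in L, forall p, (0 < p.2)%N ->
     [/\ nw <= p.1, p.1 + p.2%:Z + y <= ne & (p.2 <= h)%N]} ->
  {in K, forall k, nw <= k < ne - y} -> (h = 0%N -> K = [::]) ->
  uniq (K ++ segs L) ->
  (forall t, (t \in A) =
     [&& trap nw ne y h t, ~~ has (fun p => up_lobe y p t) L & ~~ dent K y t]) ->
  (M A)%:R = if size (K ++ segs L) == h
             then vdm (K ++ segs L) / (hfact h)%:R else 0.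
Proof.
move=> le Lb Kb hK uS AE; pose S := K ++ segs L.
(* [A0] keeps the lobes but has the segments of their bases among its dents; the box serves to form
   a finite set. *)
pose A0 := [fset t in box_triangles (Hexagon y (y + h%:Z) nw (ne - y) 0 0)
           | trap nw ne y h t && ~~ dent S y t].
have A0E t : (t \in A0) = trap nw ne y h t && ~~ dent S y t.
  rewrite !inE andb_idl //= => /andP[]; case: t => [[a b] u] /= /and4P[h1 h2 h3 h4] _.
  rewrite mem_box /=; by move: h1 h2 h3 h4 le; clear; case: u; lia.
rewrite -(@M_trap_vdm nw ne y h S A0) //.
- congr (_%:R); apply/esym.
  apply: (@M_forced (fun q => has (fun p => up_lobe y p (q.1, q.2, false)) L)).
  + move=> x b /= /hasP[[l n] pL /= /and3P[h1 h2 h3]]; rewrite !A0E /=.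
    have n0 : (0 < n)%N by move: h1 h2 h3; clear; lia.
    have [/= h4 h5 h6] := Lb _ pL n0.
    by move: h1 h2 h3 h4 h5 h6; clear; blia.
  + move=> x b /= /hasP[[l n] pL /= /and3P[h1 h2 h3]]; rewrite A0E /= => /andP[_ dS].
    apply/hasP; exists (l, n) => //=; have [yb|yb] := eqVneq b y; last first.
      by move: h1 h2 h3 yb; clear; lia.
    move: dS; rewrite yb eqxx /= mem_cat negb_or => /andP[_].
    rewrite mem_segs => /hasPn/(_ _ pL) /=.
    by move: h1 h2 h3 yb; clear; lia.
  + move=> x b /= /hasP[[l n] pL /= /and3P[h1 h2 h3]]; rewrite A0E /= => /andP[_ dS].
    apply/hasP; exists (l, n) => //=; have [yb|yb] := eqVneq b y; last first.
      by move: h1 h2 h3 yb; clear; lia.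
    move: dS; rewrite yb eqxx /= mem_cat negb_or => /andP[_].
    rewrite mem_segs => /hasPn/(_ _ pL) /=.
    by move: h1 h2 h3 yb; clear; lia.
  + move=> [[a b] u]; rewrite AE A0E -andbA.
    have [/= /andP[yb _]|//] := boolP (trap _ _ _ _ _).
    case: u => //=; last by rewrite andbC.
    have -> : has (fun p => up_lobe y p (a, b, true)) L = ((b == y) && (a \in segs L))
             || has (fun p => up_lobe y p (a, b - 1, false)) L.
      rewrite mem_segs; case: eqP => [->|by0] /=.
        rewrite [X in _ || X](_ : _ = false) ?orbF; last first.
          by apply/hasPn => -[l n] _ /=; clear; lia.
        by apply: eq_has => -[l n] /=; clear; lia.
      by apply: eq_has => -[l n] /=; move: yb by0; clear; lia.
    rewrite mem_cat; do 2!case: (_ \in _); case: eqP => _; case: has => //.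
- move=> s; rewrite mem_cat mem_segs => /orP[/Kb //|/hasP[[l n] pL] /=].
  move=> xp; have n0 : (0 < n)%N by move: xp; clear; lia.
  by have [/= h4 h5 h6] := Lb _ pL n0; move: xp h4 h5; clear; lia.
move=> h0; rewrite /S hK //=; apply/nilP; rewrite /nilp -leqn0 leqNgt.
apply/negP; case E: (segs L) => [//|s0 s'] _.
have : s0 \in segs L by rewrite E mem_head.
rewrite mem_segs => /hasP[[l n] pL] /= xp; have n0 : (0 < n)%N by move: xp; clear; lia.
by have [_ _] := Lb _ pL n0; rewrite h0 /=; move: n0; clear; lia.
Qed.

(** The half-turn about the origin; the shifts by 1 arise because a triangle is named by the lower
    left corner of its parallelogram. *)
Definition rot (t : triangle) : triangle :=
  let: (x, y, u) := t in (- x - 1, - y - 1, ~~ u).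

Lemma rotK : involutive rot.
Proof. by case=> [[x y] u] /=; rewrite negbK; congr (_, _, _); lia. Qed.

Lemma rot_share_edge t t' : share_edge (rot t) (rot t') = share_edge t t'.
Proof.
have imp u v : share_edge u v -> share_edge (rot u) (rot v).
  rewrite !share_edgeE; case: u v => [[x y] [|]] [[x' y'] u'] /=;
    rewrite !inE => /or3P[] /eqP[-> -> ->] /=; apply/or3P;
    [constructor 1|constructor 2|constructor 3|constructor 1|constructor 2|constructor 3];
    rewrite !xpair_eqE /= ?andbT; lia.
by apply/idP/idP => [/imp|/imp //]; rewrite !rotK.
Qed.

Lemma M_rot A : M (rot @` A) = M A.
Proof. apply: M_imfset; [exact: (inv_inj rotK) | exact: rot_share_edge]. Qed.

Definition down_trap (sw se y : int) (h : nat) (t : triangle) : bool :=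
  let: (a, b, u) := t in
  [&& b < y, y - h%:Z <= b, a < se & sw <= a + b + (if u then 0 else 1)].

Definition down_lobe (y : int) (p : int * nat) (t : triangle) : bool :=
  let: (a, b, u) := t in
  [&& b < y, a < p.1 + p.2%:Z & p.1 + y <= a + b + (if u then 0 else 1)].

Definition down_dent (K : seq int) (y : int) (t : triangle) : bool :=
  let: (a, b, u) := t in [&& ~~ u, b == y - 1 & a \in K].

Definition flip (x : int) : int := - x - 1.

Lemma flip_inj : injective flip.
Proof. by move=> x y; rewrite /flip; lia. Qed.

Lemma flip_segs L : perm_eq (segs [seq (- p.1 - p.2%:Z, p.2) | p <- L]) (map flip (segs L)).
Proof.
elim: L => //= -[l n] L IHL; rewrite /segs /= map_cat; apply: perm_cat => //.
apply: uniq_perm; rewrite ?irange_uniq ?(map_inj_uniq flip_inj) ?irange_uniq //.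
move=> x; rewrite -[x in RHS](_ : flip (flip x) = x); last by rewrite /flip; lia.
by rewrite (mem_map flip_inj) !mem_irange /flip; lia.
Qed.

(** The half-turn reduces this to [M_half]. It sends the segment at x to the one at -x - 1, which
    preserves distances and hence [vdm]. *)
Lemma M_lower (sw se y : int) (h : nat) (L : seq (int * nat)) (K : seq int)
    (A : {fset triangle}) :
  sw + h%:Z <= se + y ->
  {in L, forall p, (0 < p.2)%N ->
     [/\ p.1 + p.2%:Z <= se, sw <= p.1 + y & (p.2 <= h)%N]} ->
  {in K, forall k, sw - y <= k < se} -> (h = 0%N -> K = [::]) ->
  uniq (K ++ segs L) ->
  (forall t, (t \in A) =
     [&& down_trap sw se y h t, ~~ has (fun p => down_lobe y p t) L
       & ~~ down_dent K y t]) ->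
  (M A)%:R = if size (K ++ segs L) == h
             then vdm (K ++ segs L) / (hfact h)%:R else 0.
Proof.
move=> le Lb Kb hK uS AE; rewrite -M_rot.
pose L' := [seq (- p.1 - p.2%:Z, p.2) | p <- L].
have pS : perm_eq (map flip K ++ segs L') (map flip (K ++ segs L)).
  by rewrite map_cat perm_cat2l flip_segs.
rewrite (@M_half (- se) (- sw) (- y) h L' (map flip K)).
- rewrite (perm_size pS) size_map (perm_vdm pS) vdm_map // => a b.
  exact: dist_opp.
- by lia.
- by move=> p /mapP[[l n] /Lb /= bnd ->] /= /bnd[h1 h2 h3]; split; lia.
- by move=> k /mapP[k' /Kb ? ->]; rewrite /flip; lia.
- by move=> /hK ->.
- by rewrite (perm_uniq pS) (map_inj_uniq flip_inj).
move=> t; rewrite -[t in LHS]rotK mem_imfset; last exact: (inv_inj rotK).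
rewrite AE has_map; case: t => [[a b] u] /=; congr [&& _, ~~ _ & ~~ _].
- by case: u => /=; lia.
- by apply: eq_has => -[l n] /=; case: u => /=; lia.
rewrite negbK (_ : (- b - 1 == y - 1) = (b == - y)); last by lia.
congr [&& _, _ & _]; rewrite -(mem_map flip_inj) (_ : flip (- a - 1) = a) // /flip; lia.
Qed.

(** * Cutting a region along its axis *)

Definition lobe_code (l : lobe) := (lobe_left l, lobe_side l, lobe_up l, lobe_rank l).
Definition lobe_decode (x : int * nat * bool * nat) : lobe :=
  let: (l, s, u, r) := x in Lobe l s u r.
Lemma lobe_codeK : cancel lobe_code lobe_decode.
Proof. by case. Qed.
HB.instance Definition _ := Equality.copy lobe (can_type lobe_codeK).

Definition fern_code (f : fern) := (fern_left f, fern_up f, fern_sides f).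
Definition fern_decode (x : int * bool * seq nat) : fern :=
  let: (l, u, s) := x in Fern l u s.
Lemma fern_codeK : cancel fern_code fern_decode.
Proof. by case. Qed.
HB.instance Definition _ := Equality.copy fern (can_type fern_codeK).

Definition pos (x : int) : nat := if x is Posz n then n else 0%N.

Lemma posE x : (pos x)%:Z = if 0 <= x then x else 0.
Proof. by case: x. Qed.

Definition lobe_pair (l : lobe) : int * nat := (lobe_left l, lobe_side l).

Definition pairs (C : config) (up : bool) : seq (int * nat) :=
  [seq lobe_pair l | l <- lobes C & lobe_up l == up].

(* The lobes completing the parts of the hexagon above and below the axis to
   trapezoids. *)
Definition left_extra (C : config) (up : bool) : int * nat :=
  let H := outer C in
  if up then (nw H, pos (sw H - axis C - nw H))
  else (sw H - axis C, pos (nw H - (sw H - axis C))).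

Definition right_extra (C : config) (up : bool) : int * nat :=
  let H := outer C in
  if up then (se H, pos (ne H - axis C - se H))
  else (ne H - axis C, pos (se H - (ne H - axis C))).

Definition extras (C : config) (up : bool) : seq (int * nat) :=
  [:: left_extra C up; right_extra C up].

Definition full_pairs (C : config) (up : bool) := pairs C up ++ extras C up.

Lemma in_hexagon_vertices H a b u :
  all (in_hexagon H) (vertices (a, b, u)) =
  [&& bot H <= b, b < top H, nw H <= a, a < se H,
      sw H <= a + b + (if u then 0 else 1) & a + b + (if u then 1 else 2) <= ne H].
Proof. by case: u; rewrite /= /in_hexagon /=; lia. Qed.

Lemma in_lobe_vertices C l t : all (in_lobe C l) (vertices t) =
  if lobe_up l then up_lobe (axis C) (lobe_pair l) t
  else down_lobe (axis C) (lobe_pair l) t.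
Proof.
case: t l => [[a b] u] [x s [|] r]; case: u; rewrite /= /in_lobe /lobe_right /=; lia.
Qed.

Lemma has_if (T : Type) (q f g : pred T) s :
  has (fun x => if q x then f x else g x) s
  = has f (filter q s) || has g (filter (predC q) s).
Proof. by elim: s => //= x s ->; case: (q x); rewrite /= ?orbA // [_ || g x]orbC. Qed.

Lemma side_facts C : coaxial C -> let H := outer C in
  [/\ [&& top H + nw H <= ne H, sw H <= se H + bot H & sw H <= top H + nw H],
      [&& se H + bot H <= ne H, nw H + bot H <= sw H & ne H <= top H + se H],
      bot H <= top H & nw H <= se H].
Proof.
move=> /and4P[sd _ _ _] H; move: sd;
  rewrite -/H /= andbT => /and5P[h1 h2 h3 h4 /andP[h5 h6]].
by split; move: h1 h2 h3 h4 h5 h6; clear; lia.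
Qed.

Lemma lobe_facts C l : coaxial C -> l \in lobes C -> let H := outer C in
  [/\ nw H <= lobe_left l, sw H <= lobe_left l + axis C,
      lobe_left l + (lobe_side l)%:Z <= se H,
      lobe_left l + (lobe_side l)%:Z + axis C <= ne H &
      [/\ bot H <= axis C, axis C <= top H &
          if lobe_up l then axis C + (lobe_side l)%:Z <= top H
          else bot H + (lobe_side l)%:Z <= axis C]].
Proof.
move=> /and4P[_ _ _ /allP h] /h {h} + H; rewrite /= /in_hexagon /= /lobe_right !andbT -/H.
case: l => [x s u r] /= /and3P[h1 h2].
by case: u => /= h3; (split; last split); move: h1 h2 h3; clear; lia.
Qed.

Lemma mem_region C t : coaxial C ->
  (t \in region C) = [&& all (in_hexagon (outer C)) (vertices t),
    ~~ has (fun p => up_lobe (axis C) p t) (pairs C true) &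
    ~~ has (fun p => down_lobe (axis C) p t) (pairs C false)].
Proof.
move=> cC; have [_ _ tb sn] := side_facts cC.
rewrite !inE (eq_has (a2 := fun l => if lobe_up l then up_lobe (axis C) (lobe_pair l) t
  else down_lobe (axis C) (lobe_pair l) t)); last first.
  by move=> l; rewrite in_lobe_vertices.
have e1 : [seq l <- lobes C | lobe_up l == true] = filter lobe_up (lobes C).
  by apply: eq_filter => l; rewrite eqb_id.
have e2 : [seq l <- lobes C | lobe_up l == false] = filter (predC lobe_up) (lobes C).
  by apply: eq_filter => l /=; rewrite eqbF_neg.
rewrite has_if negb_or /pairs !has_map e1 e2.
apply: andb_idl => /andP[]; case: t => [[a b] u]; rewrite in_hexagon_vertices mem_box //.
by move=> h _; move: h; clear; lia.
Qed.

Definition axis_length (C : config) : nat := absz (axis_right C - axis_left C)%R.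
Definition up_height (C : config) : nat := absz (top (outer C) - axis C)%R.
Definition down_height (C : config) : nat := absz (axis C - bot (outer C))%R.

Section Halves.
Variable C : config.
Hypotheses (cC : coaxial C) (lC : lobes C != [::]).
Let H := outer C.
Let c := axis C.

Lemma axis_facts : bot H <= c <= top H.
Proof.
case E: (lobes C) lC => [//|l ls] _; have lE : l \in lobes C by rewrite E mem_head.
by have [_ _ _ _ [-> -> _]] := lobe_facts cC lE.
Qed.

Lemma up_heightE : c + (up_height C)%:Z = top H.
Proof. by have := axis_facts; rewrite /up_height -/H -/c; clear; lia. Qed.

Lemma down_heightE : bot H + (down_height C)%:Z = c.
Proof. by have := axis_facts; rewrite /down_height -/H -/c; clear; lia. Qed.

(** Above the axis, the two hexagon sides that do not bound the trapezoid cut off precisely the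
    triangles listed in [extras]; this rests on the side lengths being nonnegative. *)
Lemma mem_region_up a b u : c <= b -> ((a, b, u) \in region C) =
  trap (nw H) (ne H) c (up_height C) (a, b, u)
  && ~~ has (fun p => up_lobe c p (a, b, u)) (full_pairs C true).
Proof.
move=> cb; rewrite mem_region // in_hexagon_vertices.
have /negPf -> : ~~ has (fun p => down_lobe (axis C) p (a, b, u)) (pairs C false).
  by apply/hasPn => -[l n] _ /=; move: cb; rewrite -/c; clear; lia.
rewrite andbT.
rewrite has_cat negb_or [in RHS]andbA [in RHS]andbAC; congr (_ && _).
rewrite /= orbF !posE -/H -/c up_heightE; have /andP[h1 h2] := axis_facts.
have [h3 h4 _ _] := side_facts cC; move: h1 h2 h3 h4 cb; rewrite -/H; clear.
by case: (leP 0) => ?; case: (leP 0) => ?; case: u; lia.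
Qed.

Lemma mem_region_down a b u : b < c -> ((a, b, u) \in region C) =
  down_trap (sw H) (se H) c (down_height C) (a, b, u)
  && ~~ has (fun p => down_lobe c p (a, b, u)) (full_pairs C false).
Proof.
move=> cb; rewrite mem_region // in_hexagon_vertices.
have /negPf -> : ~~ has (fun p => up_lobe (axis C) p (a, b, u)) (pairs C true).
  by apply/hasPn => -[l n] _ /=; move: cb; rewrite -/c; clear; lia.
rewrite andTb.
rewrite has_cat negb_or [in RHS]andbA [in RHS]andbAC; congr (_ && _).
have := down_heightE; rewrite /= orbF !posE -/H -/c; have /andP[h1 h2] := axis_facts.
have [h3 h4 _ _] := side_facts cC; move: h1 h2 h3 h4 cb; rewrite -/H; clear.
by case: (leP 0) => ?; case: (leP 0) => ?; case: u; lia.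
Qed.

End Halves.

Lemma segs_cat L1 L2 : segs (L1 ++ L2) = segs L1 ++ segs L2.
Proof. by rewrite /segs map_cat flatten_cat. Qed.

Definition fern_pair (f : fern) : int * nat := (fern_left f, sumn (fern_sides f)).

(** Only the extent of each fern enters, not its division into lobes: squeezing can therefore only
    translate this list. *)
Definition axis_segs (C : config) : seq int := segs (map fern_pair (ferns C)).

Lemma segs_lobes_from x up j s :
  segs (map lobe_pair (lobes_from x up j s)) = irange x (sumn s).
Proof.
elim: s x up j => //= a s IHs x up j.
by rewrite irangeD -(IHs _ (~~ up) j.+1).
Qed.

Lemma segs_lobes C : segs (map lobe_pair (lobes C)) = axis_segs C.
Proof.
rewrite /axis_segs /lobes; elim: (ferns C) => //= f F IHF.
by rewrite map_cat segs_cat IHF segs_lobes_from.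
Qed.

Lemma perm_segs_pairs C :
  perm_eq (segs (pairs C true) ++ segs (pairs C false)) (axis_segs C).
Proof.
rewrite -segs_lobes /pairs; elim: (lobes C) => //= l s IHs.
rewrite {2}/segs /=; have [u|u] := boolP (lobe_up l); rewrite /= /segs /=.
  by rewrite -catA perm_cat2l.
by rewrite perm_catCA perm_cat2l.
Qed.

Definition fern_lt (f g : fern) := fern_right f < fern_left g.

Lemma fern_lt_trans : transitive fern_lt.
Proof.
move=> g f h; rewrite /fern_lt /fern_right => fg gh.
by apply: lt_trans fg (le_lt_trans _ gh); rewrite lerDl.
Qed.

Lemma axis_segs_uniq C : coaxial C -> uniq (axis_segs C).
Proof.
move=> /and4P[_ _ + _]; rewrite (sorted_pairwise fern_lt_trans) /axis_segs.
elim: (ferns C) => //= f F IHF /andP[/allP fF /IHF uF].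
rewrite cat_uniq irange_uniq uF andbT; apply/hasPn => x.
rewrite mem_segs mem_irange => /hasP[p /mapP[g /fF fg ->] /=].
by move: fg; rewrite /fern_lt /fern_right; lia.
Qed.

Lemma segs_pairs_sub C up : {subset segs (pairs C up) <= axis_segs C}.
Proof.
by move=> x; rewrite -(perm_mem (perm_segs_pairs C)) mem_cat; case: up => ->;
  rewrite ?orbT.
Qed.

Lemma segs_pairs_uniq C up : coaxial C -> uniq (segs (pairs C up)).
Proof.
move/axis_segs_uniq; rewrite -(perm_uniq (perm_segs_pairs C)) cat_uniq.
by case: up => /and3P[].
Qed.

Lemma axis_leftP C x :
  (axis_left C <= x) = (nw (outer C) <= x) && (sw (outer C) <= x + axis C).
Proof. by rewrite /axis_left ge_max; congr andb; lia. Qed.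

Lemma axis_rightP C x :
  (x <= axis_right C) = (x <= se (outer C)) && (x + axis C <= ne (outer C)).
Proof. by rewrite /axis_right le_min; congr andb; lia. Qed.

Lemma axis_right_ltP C x :
  (x < axis_right C) = (x < se (outer C)) && (x + axis C < ne (outer C)).
Proof. by rewrite /axis_right lt_min; congr andb; lia. Qed.

Definition cut_positions (y0 : int) (n : nat) (K : {set 'I_n}) : seq int :=
  [seq y0 + (nat_of_ord k)%:Z | k <- enum K].

Lemma mem_cut_positions y0 n (K : {set 'I_n}) x :
  reflect (exists2 k, k \in K & x = y0 + (nat_of_ord k)%:Z) (x \in cut_positions y0 K).
Proof.
apply: (iffP mapP) => [[k]|[k kK ->]]; first by rewrite mem_enum => kK ->; exists k.
by exists k; rewrite ?mem_enum.
Qed.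

Lemma size_cut_positions y0 n (K : {set 'I_n}) : size (cut_positions y0 K) = #|K|.
Proof. by rewrite size_map -cardE. Qed.

Lemma cut_positions_uniq y0 n (K : {set 'I_n}) : uniq (cut_positions y0 K).
Proof. by rewrite map_inj_uniq ?enum_uniq // => i j /addrI [] /val_inj. Qed.

Section Cutting.
Variable C : config.
Hypotheses (cC : coaxial C) (lC : lobes C != [::]).
Let H := outer C.
Let c := axis C.

Lemma pair_facts up p : p \in pairs C up ->
  [/\ nw H <= p.1, sw H <= p.1 + c, p.1 + p.2%:Z <= se H, p.1 + p.2%:Z + c <= ne H &
      if up then c + p.2%:Z <= top H else bot H + p.2%:Z <= c].
Proof.
move=> /mapP[l]; rewrite mem_filter => /andP[/eqP <- lC'] ->.
by have [? ? ? ? [_ _ ?]] := lobe_facts cC lC'.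
Qed.

Lemma segs_pairs_bound up x : x \in segs (pairs C up) -> axis_left C <= x < axis_right C.
Proof.
rewrite mem_segs => /hasP[[l n] /pair_facts[/= h1 h2 h3 h4 _] h5].
by rewrite axis_leftP axis_right_ltP -/H -/c; move: h1 h2 h3 h4 h5; clear; lia.
Qed.

Lemma segs_extras_bound up x : x \in segs (extras C up) ->
  (x < axis_left C) || (axis_right C <= x).
Proof.
have [h1 h2 _ _] := side_facts cC; have h3 := axis_facts cC lC.
rewrite mem_segs /= orbF -[_ || (axis_right C <= x)]negbK negb_or -leNgt -ltNge.
rewrite axis_leftP axis_right_ltP -/H -/c; move: h1 h2 h3; rewrite -/H -/c.
by case: up => /=; rewrite !posE -/H -/c; clear; case: (leP 0) => ?; case: (leP 0) => ?;
  lia.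
Qed.

Lemma full_segs_uniq up : uniq (segs (full_pairs C up)).
Proof.
rewrite segs_cat cat_uniq segs_pairs_uniq //=; apply/andP; split.
  apply/hasPn => x /segs_extras_bound h; apply/negP => /segs_pairs_bound.
  by move: h; clear; lia.
have [h1 h2 _ _] := side_facts cC; have h3 := axis_facts cC lC.
rewrite /segs /= cats0 cat_uniq !irange_uniq andbT; apply/hasPn => x.
rewrite /= !mem_irange; move: h1 h2 h3; rewrite -/H -/c.
by case: up => /=; rewrite !posE -/H -/c; clear; case: (leP 0) => ?; case: (leP 0) => ?;
  lia.
Qed.

Let N := axis_length C.
Let x0 := axis_left C.

Let J := segs (full_pairs C true).
Let I := segs (full_pairs C false).
Let u := up_height C.
Let v := down_height C.

Definition lower_part := [fset t in region C | t.1.2 < c].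
Definition upper_part := [fset t in region C | c <= t.1.2].

Lemma mem_lower t : (t \in lower_part) = (t \in region C) && (t.1.2 < c).
Proof. by rewrite /lower_part; move: (region C) => A; rewrite !inE. Qed.

Lemma mem_upper t : (t \in upper_part) = (t \in region C) && (c <= t.1.2).
Proof. by rewrite /upper_part; move: (region C) => A; rewrite !inE. Qed.

Lemma axis_range (k : 'I_N) : axis_left C <= x0 + (nat_of_ord k)%:Z < axis_right C.
Proof.
have := ltn_ord k; rewrite /N /axis_length /x0.
have : axis_left C <= axis_right C.
  case E: (lobes C) lC => [//|l ls] _; have lE : l \in lobes C by rewrite E mem_head.
  have [h1 h2 h3 h4 _] := lobe_facts cC lE.
  apply: (@le_trans _ _ (lobe_left l)); first by rewrite axis_leftP h1 h2.
  by rewrite axis_rightP; move: h3 h4; clear; lia.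
by clear; lia.
Qed.

Lemma region_parts : region C = lower_part `|` upper_part.
Proof.
apply/fsetP => t; rewrite in_fsetU mem_lower mem_upper -andb_orr.
by case: ltP; rewrite andbT.
Qed.

Lemma parts_separated : separated N x0 c lower_part upper_part.
Proof.
split=> [t|t|x]; rewrite ?mem_lower ?mem_upper; try by case/andP.
case/andP; rewrite mem_region // in_hexagon_vertices => /andP[h _] _.
have xb : axis_left C <= x < axis_right C.
  by rewrite axis_leftP axis_right_ltP; move: h; rewrite -/H -/c; clear; lia.
have kN : (absz (x - x0)%R < N)%N by move: xb; rewrite /N /axis_length /x0; clear; lia.
by exists (Ordinal kN); move: xb; rewrite /= /x0; clear; lia.
Qed.

Lemma crossing_up (K : {set 'I_N}) x : crossing x0 c lower_part upper_part K ->
  x \in cut_positions x0 K -> [/\ (0 < u)%N, nw H <= x < ne H - c & x \notin J].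
Proof.
move=> /forall_inP cr /mem_cut_positions[k /cr/andP[_ +] ->];
  rewrite mem_upper => /andP[+ _].
rewrite /above mem_region_up // => /andP[/= h1 h2]; split.
- by move: h1; rewrite -/u -/c; clear; lia.
- by move: h1; rewrite -/H -/c; clear; lia.
apply: contra h2; rewrite mem_segs => /hasP[[l n] pL h2]; apply/hasP;
  exists (l, n) => //=.
by move: h2; rewrite -/c /=; clear; lia.
Qed.

Lemma crossing_down (K : {set 'I_N}) x : crossing x0 c lower_part upper_part K ->
  x \in cut_positions x0 K -> [/\ (0 < v)%N, sw H - c <= x < se H & x \notin I].
Proof.
move=> /forall_inP cr /mem_cut_positions[k /cr/andP[+ _] ->];
  rewrite mem_lower => /andP[+ _].
rewrite /below mem_region_down ?ltrBlDr ?ltrDl // => /andP[/= h1 h2]; split.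
- by move: h1; rewrite -/v -/c; clear; lia.
- by move: h1; rewrite -/H -/c; clear; lia.
apply: contra h2; rewrite mem_segs => /hasP[[l n] pL h2]; apply/hasP;
  exists (l, n) => //=.
by move: h2; rewrite -/c /=; clear; lia.
Qed.

Lemma full_pairs_up p : p \in full_pairs C true -> (0 < p.2)%N ->
  [/\ nw H <= p.1, p.1 + p.2%:Z + c <= ne H & (p.2 <= u)%N].
Proof.
have uE := up_heightE cC lC; rewrite -/u -/c -/H in uE.
have [h1 h2 _ _] := side_facts cC; rewrite -/H in h1 h2.
rewrite mem_cat => /orP[|].
  case: p => l n /pair_facts[/= h3 h4 h5 h6 h7] n0.
  by split; move: h3 h4 h5 h6 h7 uE; clear; lia.
case: p => l n; rewrite !inE !xpair_eqE /= => h3 n0.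
have := posE (sw H - axis C - nw H); have := posE (ne H - axis C - se H).
rewrite -/H in h3; move: h1 h2 h3 n0 uE; rewrite -/c.
move: (pos _) (pos _) => p q; clear; case: (leP 0) => ?;
  case: (leP 0) => ? h1 h2 h3 n0 uE h4 h5;
  by split; lia.
Qed.

Lemma full_pairs_down p : p \in full_pairs C false -> (0 < p.2)%N ->
  [/\ p.1 + p.2%:Z <= se H, sw H <= p.1 + c & (p.2 <= v)%N].
Proof.
have vE := down_heightE cC lC; rewrite -/v -/c -/H in vE.
have [h1 h2 _ _] := side_facts cC; rewrite -/H in h1 h2.
rewrite mem_cat => /orP[|].
  case: p => l n /pair_facts[/= h3 h4 h5 h6 h7] n0.
  by split; move: h3 h4 h5 h6 h7 vE; clear; lia.
case: p => l n; rewrite !inE !xpair_eqE /= => h3 n0.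
have := posE (nw H - (sw H - axis C)); have := posE (se H - (ne H - axis C)).
rewrite -/H in h3; move: h1 h2 h3 n0 vE; rewrite -/c.
move: (pos _) (pos _) => p q; clear; case: (leP 0) => ?;
  case: (leP 0) => ? h1 h2 h3 n0 vE h4 h5;
  by split; lia.
Qed.

Lemma M_upper_cut (K : {set 'I_N}) : crossing x0 c lower_part upper_part K ->
  (M (cut_above x0 c upper_part K))%:R =
  if (#|K| + size J)%N == u then vdm (cut_positions x0 K ++ J) / (hfact u)%:R else 0.
Proof.
move=> cr; rewrite -(size_cut_positions x0) -size_cat.
apply: (@M_half (nw H) (ne H) c u (full_pairs C true)).
- have [h1 _ _ _] := side_facts cC; have := up_heightE cC lC.
  by move: h1; rewrite -/u -/c -/H; clear; lia.
- exact: full_pairs_up.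
- by move=> k /(crossing_up cr)[].
- move=> u0; case E: (cut_positions x0 K) => [//|k s].
  by have [] := crossing_up cr (x := k); rewrite ?E ?mem_head ?u0.
- rewrite cat_uniq cut_positions_uniq full_segs_uniq // andbT.
  by apply/hasPn => x xJ; apply/negP => /(crossing_up cr)[_ _]; rewrite xJ.
move=> [[a b] up]; rewrite in_fsetD mem_upper andbC.
have [cb|bc] /= := leP c b; last first.
  by rewrite andbF; move: bc; clear; lia.
rewrite andbT mem_region_up // -!andbA; congr [&& _, _, _, _, _ & ~~ _].
apply/imfsetP/and3P => [[k /= kK [-> -> ->]]|[-> /eqP -> /mem_cut_positions[k kK ->]]].
  by split=> //; apply/mem_cut_positions; exists k.
by exists k.
Qed.

Lemma M_lower_cut (K : {set 'I_N}) : crossing x0 c lower_part upper_part K ->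
  (M (cut_below x0 c lower_part K))%:R =
  if (#|K| + size I)%N == v then vdm (cut_positions x0 K ++ I) / (hfact v)%:R else 0.
Proof.
move=> cr; rewrite -(size_cut_positions x0) -size_cat.
apply: (@M_lower (sw H) (se H) c v (full_pairs C false)).
- have [h1 _ _ _] := side_facts cC; have := down_heightE cC lC.
  by move: h1; rewrite -/v -/c -/H; clear; lia.
- exact: full_pairs_down.
- by move=> k /(crossing_down cr)[].
- move=> v0; case E: (cut_positions x0 K) => [//|k s].
  by have [] := crossing_down cr (x := k); rewrite ?E ?mem_head ?v0.
- rewrite cat_uniq cut_positions_uniq full_segs_uniq // andbT.
  by apply/hasPn => x xJ; apply/negP => /(crossing_down cr)[_ _]; rewrite xJ.
move=> [[a b] up]; rewrite in_fsetD mem_lower andbC.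
have [bc|cb] /= := ltP b c; last by rewrite andbF [b < c]ltNge cb.
rewrite andbT mem_region_down // -!andbA; congr [&& _, _, _, _, _ & ~~ _].
apply/imfsetP/and3P => [[k /= kK [-> -> ->]]|[]].
  by split=> //; apply/mem_cut_positions; exists k.
by case: up => // _ /eqP -> /mem_cut_positions[k kK ->]; exists k.
Qed.

(** Unlike [crossing], this condition refers only to covered positions and to cardinalities, which
    can be followed under squeezing. Crossing sets that violate it contribute 0. *)
Definition admissible (K : {set 'I_N}) :=
  [&& all (fun x => x \notin axis_segs C) (cut_positions x0 K),
      (#|K| + size J)%N == u & (#|K| + size I)%N == v].

Lemma admissible_crossing K : admissible K -> crossing x0 c lower_part upper_part K.
Proof.
move=> /and3P[/allP nO /eqP uE /eqP vE]; apply/forall_inP => k kK.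
(* A nonempty [K] forces both heights to be positive, so that the unit triangles on either side of
   the axis do lie in the hexagon. *)
have K0 : (0 < #|K|)%N by apply/card_gt0P; exists k.
have u0 : (0 < u)%N by move: K0 uE; clear; lia.
have v0 : (0 < v)%N by move: K0 vE; clear; lia.
have := axis_range k; rewrite axis_leftP axis_right_ltP -/H -/c => xb.
have uE' := up_heightE cC lC; have vE' := down_heightE cC lC.
rewrite -/u -/v -/c -/H in uE' vE'.
have nP up : x0 + (nat_of_ord k)%:Z \notin segs (pairs C up).
  by apply: contra (nO (x0 + (nat_of_ord k)%:Z) _);
    [exact: segs_pairs_sub | apply/mem_cut_positions; exists k].
rewrite mem_lower mem_upper /= lexx ltrBlDr ltrDl ltr01 !andbT /below /above !mem_region //.
rewrite !in_hexagon_vertices -/H -/c; apply/andP; split; apply/and3P; split.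
- by move: xb u0 v0 uE' vE'; clear; lia.
- by apply/hasPn => -[l n] _ /=; rewrite -/c; clear; lia.
- have := nP false; rewrite mem_segs => /hasPn h; apply/hasPn => -[l n] /h /=.
  by rewrite -/c; clear; lia.
- by move: xb u0 v0 uE' vE'; clear; lia.
- have := nP true; rewrite mem_segs => /hasPn h; apply/hasPn => -[l n] /h /=.
  by rewrite -/c; clear; lia.
- by apply/hasPn => -[l n] _ /=; rewrite -/c; clear; lia.
Qed.

Lemma crossing_admissible K : crossing x0 c lower_part upper_part K ->
  (#|K| + size J)%N = u -> (#|K| + size I)%N = v -> admissible K.
Proof.
move=> cr uE vE; rewrite /admissible uE vE !eqxx !andbT; apply/allP => x xK.
have [_ _] := crossing_up cr xK; have [_ _] := crossing_down cr xK.
rewrite /I /J !segs_cat !mem_cat !negb_or => /andP[h1 _] /andP[h2 _].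
by rewrite -(perm_mem (perm_segs_pairs C)) mem_cat negb_or h1 h2.
Qed.

Lemma M_region_sum : (M (region C))%:R =
  \sum_(K | admissible K) (vdm (cut_positions x0 K ++ I) / (hfact v)%:R)
                  * (vdm (cut_positions x0 K ++ J) / (hfact u)%:R).
Proof.
rewrite region_parts (M_cut parts_separated) /cut_sum natr_sum (bigID admissible) /=.
(* For a crossing set of the wrong size, one of the two halves cannot be tiled. *)
rewrite [X in _ + X]big1 ?addr0 => [|K /andP[cr nok]]; last first.
  rewrite natrM M_upper_cut // M_lower_cut //.
  case: eqP => [vE|_]; last by rewrite mul0r.
  case: eqP => [uE|_]; last by rewrite mulr0.
  by rewrite crossing_admissible in nok.
apply: eq_big => [K|K /andP[cr /and3P[_ /eqP uE /eqP vE]]].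
  by rewrite andb_idl //; exact: admissible_crossing.
by rewrite natrM M_upper_cut // M_lower_cut // uE vE !eqxx.
Qed.

End Cutting.

(** What remains of the sum over K after the Vandermonde products of the fixed positions are taken
    out: [O] are the covered positions, [F] all fixed positions of both halves, and [p], [q] the
    sizes of K that the halves demand, as integers since they may be negative. *)
Definition cut_weight (y0 : int) (n : nat) (O F : seq int) (p q : int) : rat :=
  \sum_(K : {set 'I_n} | [&& all (fun x => x \notin O) (cut_positions y0 K),
                            #|K|%:Z == p & #|K|%:Z == q])
     vdm (cut_positions y0 K) ^+ 2 * cross (cut_positions y0 K) F.

Lemma cut_weight_shift d y0 n O F p q :
  cut_weight (y0 + d) n (map (+%R^~ d) O) (map (+%R^~ d) F) p q
  = cut_weight y0 n O F p q.
Proof.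
have KE (K : {set 'I_n}) : cut_positions (y0 + d) K = map (+%R^~ d) (cut_positions y0 K).
  by rewrite -map_comp; apply: eq_map => k /=; rewrite addrAC.
apply: eq_big => [K|K _]; rewrite KE.
  rewrite all_map; congr (_ && _); apply: eq_all => x /=.
  by rewrite (mem_map (@addIr _ d)).
by rewrite cross_shift vdm_map // => x y; exact: dist_shift.
Qed.

Definition config_weight (C : config) : rat :=
  cut_weight (axis_left C) (axis_length C) (axis_segs C)
    (axis_segs C ++ segs (extras C true) ++ segs (extras C false))
    ((up_height C)%:Z - (size (segs (full_pairs C true)))%:Z)
    ((down_height C)%:Z - (size (segs (full_pairs C false)))%:Z).

Lemma perm_full_segs C : perm_eq (segs (full_pairs C false) ++ segs (full_pairs C true))
   (axis_segs C ++ segs (extras C true) ++ segs (extras C false)).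
Proof.
apply/permP => a; have /permP/(_ a) := perm_segs_pairs C.
rewrite !segs_cat !count_cat => <-; lia.
Qed.

Lemma eq_addn_subz (a b c : nat) : (a + b == c)%N = (a%:Z == c%:Z - b%:Z).
Proof. lia. Qed.

Lemma M_region_factor C : coaxial C -> lobes C != [::] ->
  (M (region C))%:R = vdm (segs (full_pairs C true)) * vdm (segs (full_pairs C false))
    / ((hfact (up_height C))%:R * (hfact (down_height C))%:R) * config_weight C.
Proof.
move=> cC lC; rewrite (M_region_sum cC lC) /config_weight /cut_weight big_distrr /=.
apply: eq_big => [K|K _].
  by rewrite /admissible !eq_addn_subz.
rewrite -(perm_crossr _ (perm_full_segs C)) cross_catr !vdm_cat invfM.
by ring.
Qed.

(** * The factors due to the missing corners *)

Definition hfactz (x : int) : rat := (hfact (absz x))%:R.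

Lemma hfactz_neq0 x : hfactz x != 0.
Proof.
rewrite pnatr_eq0 -lt0n; apply: (big_ind (fun m => (0 < m)%N)) => //.
  by move=> a b a0 b0; rewrite muln_gt0 a0.
by move=> i _; exact: fact_gt0.
Qed.

Lemma hfactz_succ (n : nat) : hfactz n.+1 = hfactz n * (n`!)%:R.
Proof. by rewrite /hfactz /hfact big_ord_recr natrM. Qed.

Lemma irangeS l n : irange l n.+1 = irange l n ++ [:: l + n%:Z].
Proof. by rewrite -addn1 irangeD /irange /= addr0. Qed.

Lemma prod_dist_left (i : nat) p n :
  \prod_(y <- irange p n) dist (p + n%:Z + i%:Z) y = ((n + i)`!)%:R / (i`!)%:R.
Proof.
elim: n i => [|n IHn] i.
  by rewrite big_nil add0n divff // pnatr_eq0 -lt0n fact_gt0.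
have -> : p + n.+1%:Z + i%:Z = p + n%:Z + i.+1%:Z by lia.
rewrite irangeS big_cat big_seq1 /= IHn addnS -addSn /dist -intrB.
rewrite (_ : p + n%:Z + i.+1%:Z - _ = i.+1); last by lia.
rewrite gtr0_norm ?ltr0z // (factS i) natrM; move: (n.+1 + i)%N => m.
have h1 : (i.+1)%:R != 0 :> rat by rewrite pnatr_eq0.
have h2 : (i`!)%:R != 0 :> rat by rewrite pnatr_eq0 -lt0n fact_gt0.
by rewrite -pmulrn; move: (i.+1%:R) h1 => z z0; field; rewrite z0 h2.
Qed.

Lemma prod_dist_right (i : nat) x n :
  \prod_(y <- irange (x + 1 + i%:Z) n) dist x y = ((n + i)`!)%:R / (i`!)%:R.
Proof.
elim: n => [|n IHn].
  by rewrite big_nil add0n divff // pnatr_eq0 -lt0n fact_gt0.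
rewrite irangeS big_cat big_seq1 /= IHn addSn factS natrM distC /dist -intrB.
rewrite (_ : x + 1 + i%:Z + n%:Z - x = (n + i).+1); last by lia.
by rewrite gtr0_norm ?ltr0z // -pmulrn; ring.
Qed.

(** Each further position contributes a ratio of two factorials, that is, of consecutive values of
    [hfactz]. The right side is f(l + a) / f(l) with f(x) = h(x - p) / h(x - p - n), the form that
    telescopes over adjacent lobes. *)
Lemma cross_left l a p n : p + n%:Z <= l ->
  cross (irange l a) (irange p n) =
  (hfactz (l + a%:Z - p) / hfactz (l + a%:Z - (p + n%:Z)))
  / (hfactz (l - p) / hfactz (l - (p + n%:Z))).
Proof.
move=> pl; elim: a => [|a IHa].
  by rewrite /cross big_nil addr0 divff // mulf_neq0 ?invr_eq0 ?hfactz_neq0.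
rewrite irangeS cross_catl IHa /cross big_seq1.
have [i iE] : exists i : nat, l + a%:Z = p + n%:Z + i%:Z.
  by exists (absz (l + a%:Z - (p + n%:Z))%R); move: pl; clear; lia.
rewrite iE prod_dist_left.
have -> : l + a.+1%:Z - p = ((n + i).+1)%:Z by move: iE; clear; lia.
have -> : l + a.+1%:Z - (p + n%:Z) = (i.+1)%:Z by move: iE; clear; lia.
have -> : p + n%:Z + i%:Z - p = (n + i)%N by clear; lia.
have -> : p + n%:Z + i%:Z - (p + n%:Z) = i by clear; lia.
rewrite !hfactz_succ.
have h2 m : (m`!)%:R != 0 :> rat by rewrite pnatr_eq0 -lt0n fact_gt0.
by field; rewrite !h2 !hfactz_neq0.
Qed.

Lemma cross_right l a p n : l + a%:Z <= p ->
  cross (irange l a) (irange p n) =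
  (hfactz (p - (l + a%:Z)) / hfactz (p + n%:Z - (l + a%:Z)))
  / (hfactz (p - l) / hfactz (p + n%:Z - l)).
Proof.
elim: a => [|a IHa] pl.
  by rewrite /cross big_nil addr0 divff // mulf_neq0 ?invr_eq0 ?hfactz_neq0.
rewrite irangeS cross_catl IHa; last by move: pl; clear; lia.
rewrite /cross big_seq1.
have [i iE] : exists i : nat, p = l + a%:Z + 1 + i%:Z.
  by exists (absz (p - (l + a%:Z + 1))%R); move: pl; clear; lia.
rewrite [in X in _ * X]iE prod_dist_right.
have -> : p - (l + a.+1%:Z) = i%:Z by move: iE; clear; lia.
have -> : p + n%:Z - (l + a.+1%:Z) = (n + i)%N by move: iE; clear; lia.
have -> : p - (l + a%:Z) = (i.+1)%:Z by move: iE; clear; lia.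
have -> : p + n%:Z - (l + a%:Z) = ((n + i).+1)%:Z by move: iE; clear; lia.
rewrite !hfactz_succ.
have h2 m : (m`!)%:R != 0 :> rat by rewrite pnatr_eq0 -lt0n fact_gt0.
by field; rewrite !h2 !hfactz_neq0.
Qed.

Lemma pos_eq0 x : x <= 0 -> pos x = 0%N.
Proof. by case: x => [[|n]|n]. Qed.

Lemma posK x : 0 <= x -> (pos x)%:Z = x.
Proof. by rewrite posE => ->. Qed.

(** The function that telescopes for the missing corner at the left end; its arguments are the
    distances from the axis point at [x] to the north-western and south-western sides. *)
Definition betaL (C : config) (x : int) : rat :=
  hfactz (x - nw (outer C)) / hfactz (x + axis C - sw (outer C)).

Definition betaR (C : config) (x : int) : rat :=
  hfactz (se (outer C) - x) / hfactz (ne (outer C) - (x + axis C)).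

Definition signed_power (o : bool) (f : int -> rat) (x : int) : rat :=
  if o then f x else (f x)^-1.

(* Whether the corner missing at the left (at the right) end of the axis lies
   above the axis. *)
Definition left_up (C : config) : bool := nw (outer C) + axis C <= sw (outer C).
Definition right_up (C : config) : bool := se (outer C) + axis C <= ne (outer C).

Lemma cross0 s p : cross s (irange p 0) = 1.
Proof. by rewrite /cross big1 // => x _; rewrite big_nil. Qed.

(** Only the corner on the side given by [left_up] can have positive side. If it lies below the
    axis, the two sides of the hexagon exchange roles, which inverts [betaL]. *)
Lemma cross_left_extra C l : coaxial C -> l \in lobes C ->
  cross (irange (lobe_left l) (lobe_side l))
        (irange (left_extra C (lobe_up l)).1 (left_extra C (lobe_up l)).2)
  = if lobe_up l == left_up C
    then signed_power (left_up C) (betaL C) (lobe_right l)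
         / signed_power (left_up C) (betaL C) (lobe_left l)
    else 1.
Proof.
move=> cC lC; have [h1 h2 h3 h4 _] := lobe_facts cC lC.
rewrite /left_extra /left_up /lobe_right; case: (lobe_up l) => /=.
  case: leP => h /=.
    have hp := @posK (sw (outer C) - axis C - nw (outer C)) ltac:(move: h; clear; lia).
    rewrite cross_left; last by move: hp h h2; clear; lia.
    by rewrite /betaL hp; congr (_ / hfactz _ / (_ / hfactz _)); clear; lia.
  rewrite (pos_eq0 (x := sw (outer C) - axis C - nw (outer C))); last by move: h; clear;
    lia.
  exact: cross0.
case: leP => h /=.
  rewrite (pos_eq0 (x := nw (outer C) - (sw (outer C) - axis C))); last by move: h;
    clear; lia.
  exact: cross0.
have hp := @posK (nw (outer C) - (sw (outer C) - axis C)) ltac:(move: h; clear; lia).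
rewrite cross_left; last by move: hp h h1; clear; lia.
rewrite /betaL hp !invf_div; congr (hfactz _ / hfactz _ * (hfactz _ / hfactz _)); clear;
  lia.
Qed.

Lemma cross_right_extra C l : coaxial C -> l \in lobes C ->
  cross (irange (lobe_left l) (lobe_side l))
        (irange (right_extra C (lobe_up l)).1 (right_extra C (lobe_up l)).2)
  = if lobe_up l == right_up C
    then signed_power (right_up C) (betaR C) (lobe_right l)
         / signed_power (right_up C) (betaR C) (lobe_left l)
    else 1.
Proof.
move=> cC lC; have [h1 h2 h3 h4 _] := lobe_facts cC lC.
rewrite /right_extra /right_up /lobe_right; case: (lobe_up l) => /=.
  case: leP => h /=.
    have hp := @posK (ne (outer C) - axis C - se (outer C)) ltac:(move: h; clear; lia).
    rewrite cross_right; last by move: hp h h3; clear; lia.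
    by rewrite /betaR hp; congr (_ / hfactz _ / (_ / hfactz _)); clear; lia.
  rewrite (pos_eq0 (x := ne (outer C) - axis C - se (outer C))); last by move: h; clear;
    lia.
  exact: cross0.
case: leP => h /=.
  rewrite (pos_eq0 (x := se (outer C) - (ne (outer C) - axis C))); last by move: h;
    clear; lia.
  exact: cross0.
have hp := @posK (se (outer C) - (ne (outer C) - axis C)) ltac:(move: h; clear; lia).
rewrite cross_right; last by move: hp h h4; clear; lia.
rewrite /betaR hp !invf_div; congr (hfactz _ / hfactz _ * (hfactz _ / hfactz _)); clear;
  lia.
Qed.

Definition fern_last (f : fern) : bool := fern_up f (+) ~~ odd (size (fern_sides f)).

(** The boundary terms of the telescoping product along a fern; they depend only on its two ends and
    on the orientations of its first and last lobes. *)
Definition fern_ends (o : bool) (b : int -> rat) (f : fern) : rat :=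
  (if fern_up f == o then (signed_power o b (fern_left f))^-1 else 1)
  * (if fern_last f == o then signed_power o b (fern_right f) else 1).

Definition fern_nodes (f : fern) := zip (fern_lobes f) (behead (fern_lobes f)).

(** At a node exactly one of the two lobes has orientation [o]: the left one contributes its right
    end, the right one the inverse of its left end. Together with the exponent in [signed_power],
    the factor of the node comes out independent of [o], that is, of the side on which the corner
    lies. *)
Lemma prod_lobes_fern o b f : (forall x, b x != 0) -> fern_sides f != [::] ->
  \prod_(l <- fern_lobes f | lobe_up l == o)
     (signed_power o b (lobe_right l) / signed_power o b (lobe_left l))
  = fern_ends o b f * \prod_(A <- fern_nodes f) signed_power (lobe_up A.1) b (lobe_right A.1).
Proof.
move=> b0; case: f => x up s; rewrite /fern_ends /fern_nodes /fern_last.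
rewrite /fern_right /fern_lobes /=.
case: s => // a s _; move: 0%N => j.
elim: s x up j a => [|a' s IHs] x up j a.
  rewrite /= big_cons !big_nil addbF addn0 /lobe_right /=.
  by case: eqP => _; rewrite ?mulr1 // mulrC.
have zipE : zip (lobes_from x up j [:: a, a' & s]) (behead (lobes_from x up j [:: a, a' & s]))
  = (Lobe x a up j, Lobe (x + a%:Z) a' (~~ up) j.+1)
    :: zip (lobes_from (x + a%:Z) (~~ up) j.+1 (a' :: s))
           (behead (lobes_from (x + a%:Z) (~~ up) j.+1 (a' :: s))) by [].
rewrite zipE big_cons {zipE}.
have -> : lobes_from x up j [:: a, a' & s]
  = Lobe x a up j :: lobes_from (x + a%:Z) (~~ up) j.+1 (a' :: s) by [].
rewrite big_cons IHs /lobe_right.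
move: (\prod_(A <- _) _) => P.
have -> : ~~ up (+) ~~ odd (size (a' :: s)) = up (+) ~~ odd (size [:: a, a' & s]).
  by rewrite /=; case: up; case: odd.
have -> : x + a%:Z + (sumn (a' :: s))%:Z = x + (sumn [:: a, a' & s])%:Z.
  by rewrite /= [in RHS]PoszD addrA.
move: (if up (+) _ == o then _ else _) => L; rewrite /signed_power /=.
have := b0 x; have := b0 (x + a%:Z); move: (b x) (b (x + a%:Z)) => p q.
by clear; case: up; case: o => /= q0 p0; field; rewrite ?p0 ?q0.
Qed.

Lemma betaL_neq0 C x : betaL C x != 0.
Proof. by rewrite mulf_neq0 ?invr_eq0 ?hfactz_neq0. Qed.

Lemma betaR_neq0 C x : betaR C x != 0.
Proof. by rewrite mulf_neq0 ?invr_eq0 ?hfactz_neq0. Qed.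

Definition config_ends (C : config) : rat :=
  \prod_(f <- ferns C) (fern_ends (left_up C) (betaL C) f
                       * fern_ends (right_up C) (betaR C) f).

Lemma cross_segs L t : cross (segs L) t = \prod_(p <- L) cross (irange p.1 p.2) t.
Proof.
elim: L => [|p L IHL]; first by rewrite /cross !big_nil.
by rewrite big_cons -IHL -cross_catl.
Qed.

Lemma prod_lobes C o b : coaxial C -> (forall x, b x != 0) ->
  \prod_(l <- lobes C | lobe_up l == o)
     (signed_power o b (lobe_right l) / signed_power o b (lobe_left l))
  = (\prod_(f <- ferns C) fern_ends o b f)
    * \prod_(A <- nodes C) signed_power (lobe_up A.1) b (lobe_right A.1).
Proof.
move=> /and4P[_ + _ _] b0; rewrite /lobes /nodes.
elim: (ferns C) => [|f F IHF] /=; first by rewrite !big_nil mulr1.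
move=> /andP[f0 /IHF{}IHF]; rewrite big_cons !big_cat /= IHF prod_lobes_fern //.
rewrite -/(fern_nodes f); move: (\prod_(A <- fern_nodes f) _) => P.
move: (\prod_(A <- _) _) => P'; ring.
Qed.

Lemma cross_full C : coaxial C ->
  cross (segs (pairs C true)) (segs (extras C true))
  * cross (segs (pairs C false)) (segs (extras C false))
  = config_ends C * \prod_(A <- nodes C)
     (signed_power (lobe_up A.1) (betaL C) (lobe_right A.1)
      * signed_power (lobe_up A.1) (betaR C) (lobe_right A.1)).
Proof.
move=> cC.
have one up : cross (segs (pairs C up)) (segs (extras C up)) =
    \prod_(l <- lobes C | lobe_up l == up)
      ((if lobe_up l == left_up C
        then signed_power (left_up C) (betaL C) (lobe_right l)
         / signed_power (left_up C) (betaL C) (lobe_left l)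
        else 1) *
       (if lobe_up l == right_up C
        then signed_power (right_up C) (betaR C) (lobe_right l)
         / signed_power (right_up C) (betaR C) (lobe_left l)
        else 1)).
  rewrite cross_segs /pairs big_map big_filter big_seq_cond [RHS]big_seq_cond.
  apply: eq_bigr => l /andP[lC /eqP <-].
  rewrite /extras /segs /= cats0 cross_catr.
  by rewrite cross_left_extra // cross_right_extra.
rewrite !one.
have -> : forall F, (\prod_(l <- lobes C | lobe_up l == true) F l)
    * (\prod_(l <- lobes C | lobe_up l == false) F l) = \prod_(l <- lobes C) F l :> rat.
  move=> F; rewrite [RHS](bigID lobe_up) /=; congr (_ * _); apply: eq_bigl => l.
    by rewrite eqb_id.
  by rewrite eqbF_neg.
rewrite [\prod_(l <- lobes C) _]big_split -!big_mkcond /=.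
rewrite (prod_lobes _ cC (betaL_neq0 C)) (prod_lobes _ cC (betaR_neq0 C)) mulrACA.
rewrite -[in LHS]big_split; congr (_ * _); exact/esym/big_split.
Qed.

Lemma vdm_full C : coaxial C ->
  vdm (segs (full_pairs C true)) * vdm (segs (full_pairs C false)) =
  vdm (segs (pairs C true)) * vdm (segs (pairs C false))
  * (vdm (segs (extras C true)) * vdm (segs (extras C false)) * config_ends C)
  * \prod_(A <- nodes C)
     (signed_power (lobe_up A.1) (betaL C) (lobe_right A.1)
      * signed_power (lobe_up A.1) (betaR C) (lobe_right A.1)).
Proof.
move=> cC; have := cross_full cC; rewrite !segs_cat !vdm_cat.
move: (cross _ _) (cross _ _) (\prod_(A <- _) _) => p q r e.
by rewrite -!mulrA -e; ring.
Qed.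

(** * Weight, nodes and support lines *)

Lemma Delta_vdm a (s : seq nat) : sorted ltn s ->
  Delta s = vdm (map (fun k => a + k%:Z) s).
Proof.
move=> ss; rewrite -vdm_sorted; last first.
  by rewrite sorted_map; apply: sub_sorted ss => i j /= ij; rewrite ltrD2l ltz_nat.
rewrite /Delta size_map; apply: eq_bigr => j _; apply: eq_bigr => i _.
rewrite !(nth_map 0%N) ?(ltn_trans (ltn_ord i)) //.
by rewrite !intrD opprD addrACA subrr add0r -!pmulrn.
Qed.

Lemma labels_sorted C up : sorted ltn (labels C up).
Proof. by rewrite sorted_filter ?iota_ltn_sorted //; exact: ltn_trans. Qed.

Lemma Delta_labels_neq0 C up : Delta (labels C up) != 0.
Proof.
rewrite (Delta_vdm 0) ?labels_sorted // vdm_neq0 // map_inj_uniq.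
  exact: sorted_uniq ltn_trans ltnn _ (labels_sorted C up).
by move=> i j /addrI [].
Qed.

Lemma weight_neq0 C : weight C != 0.
Proof. by rewrite mulf_neq0 ?Delta_labels_neq0. Qed.

Lemma Delta_labels C up : coaxial C -> Delta (labels C up) = vdm (segs (pairs C up)).
Proof.
(* Labels start from 1, so label k is the segment starting at [axis_left C + k - 1]. *)
move=> cC; rewrite (Delta_vdm (axis_left C - 1)) ?labels_sorted //; apply: perm_vdm.
apply: uniq_perm.
- rewrite map_inj_uniq; last by move=> i j /addrI [].
  exact: sorted_uniq ltn_trans ltnn _ (labels_sorted C up).
- exact: segs_pairs_uniq.
have hasE k :
   has (fun l => (lobe_up l == up)
      && (lobe_left l <= axis_left C + k%:Z - 1 < lobe_right l)) (lobes C)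
   = (axis_left C - 1 + k%:Z \in segs (pairs C up)).
  rewrite mem_segs has_map; elim: (lobes C) => //= l s ->.
  by case: (lobe_up l == up) => //=; congr (_ || _); rewrite /lobe_right; clear; lia.
move=> x; apply/mapP/idP => [[k]|xS].
  by rewrite mem_filter hasE => /andP[kS _] ->.
have xb := segs_pairs_bound cC xS.
exists (absz (x - axis_left C + 1)%R); last by move: xb; clear; lia.
rewrite mem_filter hasE; apply/andP; split; last first.
  by rewrite mem_iota; move: xb; clear; lia.
by rewrite (_ : _ + _ = x) //; move: xb; clear; lia.
Qed.

Lemma pairwise_mem (T : eqType) (r : rel T) s : pairwise r s ->
  forall x y, x \in s -> y \in s -> [\/ x = y, r x y | r y x].
Proof.
elim: s => //= z s IHs /andP[/allP zs /IHs{}IHs] x y; rewrite !inE.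
move=> /predU1P[->|xs] /predU1P[->|ys]; [by constructor 1| | |exact: IHs].
  by constructor 2; exact: zs.
by constructor 3; exact: zs.
Qed.

(** * Bijection between nodes and oblique support lines *)

Section Lines.
Variable C : config.
Hypothesis cC : coaxial C.

Definition left_line (l : lobe) : line :=
  let fl := if lobe_up l then Rising else Falling in
  (fl, coord fl (lobe_left l, axis C), lobe_rank l).

Definition right_line (l : lobe) : line :=
  let fr := if lobe_up l then Falling else Rising in
  (fr, coord fr (lobe_right l, axis C), (lobe_rank l).+1).

Lemma mem_edge_lines l L : (L \in edge_lines C l) =
  [|| L == axis_line C, L == left_line l | L == right_line l].
Proof. by rewrite !inE. Qed.

(** For an oblique line, the point where it meets the axis. *)
Definition abscissa (L : line) : int :=
  if L.1.1 is Falling then L.1.2 - axis C else L.1.2.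

Lemma abscissa_left l : abscissa (left_line l) = lobe_left l.
Proof. by rewrite /abscissa /left_line /=; case: lobe_up => //=; rewrite addrK. Qed.

Lemma abscissa_right l : abscissa (right_line l) = lobe_right l.
Proof. by rewrite /abscissa /right_line /=; case: lobe_up => //=; rewrite addrK. Qed.

Lemma right_line_neq_axis l : right_line l != axis_line C.
Proof. by rewrite /right_line !xpair_eqE; case: lobe_up. Qed.

Lemma map_rank_lobes_from x up j s :
  map lobe_rank (lobes_from x up j s) = iota j (size s).
Proof. by elim: s x up j => //= a s IHs x up j; rewrite IHs. Qed.

Lemma lobes_from_bound x up j s l : l \in lobes_from x up j s ->
  (x <= lobe_left l) && (lobe_left l <= lobe_right l) && (lobe_right l <= x + (sumn s)%:Z).
Proof.
elim: s x up j => //= a s IHs x up j; rewrite inE => /orP[/eqP ->|/IHs].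
  by rewrite /lobe_right /=; clear; lia.
by clear; lia.
Qed.

Lemma zip_behead x up j s A :
  A \in zip (lobes_from x up j s) (behead (lobes_from x up j s)) ->
  [/\ A.1 \in lobes_from x up j s, A.2 \in lobes_from x up j s,
      lobe_rank A.2 = (lobe_rank A.1).+1 & right_line A.1 = left_line A.2].
Proof.
elim: s x up j => //= a [|a' s] IHs x up j //; rewrite [zip _ _]/= inE => /orP[/eqP ->|].
  split; rewrite ?inE ?eqxx ?orbT //=.
  by rewrite /right_line /left_line /lobe_right /=; case: up.
by move=> /IHs[h1 h2 h3 h4]; split=> //; rewrite inE ?h1 ?h2 orbT.
Qed.

Lemma mem_zip_behead x up j s l l' : l \in lobes_from x up j s ->
  l' \in lobes_from x up j s -> lobe_rank l' = (lobe_rank l).+1 ->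
  (l, l') \in zip (lobes_from x up j s) (behead (lobes_from x up j s)).
Proof.
have rk y v i r m : m \in lobes_from y v i r -> (i <= lobe_rank m)%N.
  move=> /(map_f lobe_rank); rewrite map_rank_lobes_from mem_iota; by case/andP.
elim: s x up j => //= a s IHs x up j;
  rewrite !inE => /orP[/eqP ->|ls] /orP[/eqP ->|ls'] /= rE.
- by move: rE; clear; lia.
- case: s {IHs} ls' => //= a' s; rewrite !inE => /orP[/eqP -> //|ls'].
    by rewrite eqxx.
  by have := rk _ _ _ _ _ ls'; rewrite rE; clear; lia.
- by have := rk _ _ _ _ _ ls; move: rE; clear; lia.
case: s IHs ls ls' => // a' s IHs ls ls'.
rewrite [zip _ _]/= inE; apply/orP; right; exact: IHs.
Qed.

(** Within a fern the marks differ; for different ferns the intersections with the axis do, as the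
    ferns are strictly separated. *)
Lemma uniq_fern_lines (g : lobe -> line) (rk : lobe -> nat) :
  (forall l, (g l).2 = rk l) -> (forall x up j s, uniq (map rk (lobes_from x up j s))) ->
  (forall l, lobe_left l <= abscissa (g l) <= lobe_right l) ->
  uniq (map g (lobes C)).
Proof.
move=> gr ur ga; have /and4P[_ _ + _] := cC.
rewrite (sorted_pairwise fern_lt_trans) /lobes.
elim: (ferns C) => //= f F IHF /andP[/allP fF /IHF uF].
rewrite map_cat cat_uniq uF andbT; apply/andP; split.
  apply: (@map_uniq _ _ snd); rewrite -map_comp (eq_map (g := rk)) //; exact: ur.
apply/hasPn => L /mapP[l /flattenP[ls /mapP[h /fF fh ->] /lobes_from_bound lh] ->].
apply/negP => /mapP[l' /lobes_from_bound lf e].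
have := ga l; rewrite e; have := ga l'; move: lh lf fh.
by rewrite /fern_lt /fern_right; clear; lia.
Qed.

Lemma uniq_left_lines : uniq (map left_line (lobes C)).
Proof.
apply: (@uniq_fern_lines _ lobe_rank) => // [x up j s|l].
  by rewrite map_rank_lobes_from iota_uniq.
by rewrite abscissa_left lexx lerDl.
Qed.

Lemma uniq_right_lines : uniq (map right_line (lobes C)).
Proof.
apply: (@uniq_fern_lines _ (fun l => (lobe_rank l).+1)) => // [x up j s|l].
  by rewrite (map_comp S) (map_inj_uniq succn_inj) map_rank_lobes_from iota_uniq.
by rewrite abscissa_right lexx lerDl.
Qed.

Lemma node_facts A : A \in nodes C ->
  [/\ A.1 \in lobes C, A.2 \in lobes C, lobe_rank A.2 = (lobe_rank A.1).+1 &
      right_line A.1 = left_line A.2].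
Proof.
move=> /flattenP[zs /mapP[f fC ->] /zip_behead[h1 h2 h3 h4]].
split=> //; apply/flattenP; exists (fern_lobes f) => //; exact: map_f.
Qed.

(** The common line meets the axis in an end of both lobes, so strict separation puts them in the
    same fern; the marks then make them consecutive, even among degenerate lobes. *)
Lemma same_line_node l l' : l \in lobes C -> l' \in lobes C ->
  right_line l = left_line l' -> (l, l') \in nodes C.
Proof.
move=> /flattenP[ls /mapP[f fC ->] lf] /flattenP[ls' /mapP[f' fC' ->] lf'] e.
have ea : lobe_right l = lobe_left l' by rewrite -abscissa_left -e abscissa_right.
have er : lobe_rank l' = (lobe_rank l).+1 by case: e.
suff ff' : f = f'.
  apply/flattenP; exists (fern_nodes f); first exact: map_f.
  by apply: mem_zip_behead => //; rewrite ff'.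
have /and4P[_ _ + _] := cC; rewrite (sorted_pairwise fern_lt_trans) => /pairwise_mem.
have := lobes_from_bound lf; have := lobes_from_bound lf'; move: ea.
move=> ea b b' /(_ _ _ fC fC')[//||]; rewrite /fern_lt /fern_right; move: ea b b'; clear;
  lia.
Qed.

(** A line carries the left edge of at most one lobe and the right edge of at most one, so two lobes
    can share it only at a node. *)
Lemma count_edge_lines L : L != axis_line C ->
  (1 < count (fun l => L \in edge_lines C l) (lobes C))%N
  = (L \in map (fun A => right_line A.1) (nodes C)).
Proof.
move=> La; apply/idP/mapP => [cnt|[A /node_facts[h1 h2 h3 h4] LE]].
  have cntE : (count (fun l => L \in edge_lines C l) (lobes C) <=
      count_mem L (map left_line (lobes C)) + count_mem L (map right_line (lobes C)))%N.
    rewrite !count_map; elim: (lobes C) => //= l s IHs.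
    rewrite mem_edge_lines (negPf La) /= addnACA leq_add //.
    by rewrite ![_ == L]eq_sym; do 2!case: (L == _).
  have := leq_trans cnt cntE.
  rewrite !count_uniq_mem ?uniq_left_lines ?uniq_right_lines //.
  case: (boolP (L \in map left_line _)) => [/mapP[l' lC' e']|_];
    case: (boolP (L \in map right_line _)) => [/mapP[l lC e]|_] //= _.
  by exists (l, l') => //; apply: same_line_node => //; rewrite -e.
rewrite -size_filter; apply: (@uniq_leq_size _ [:: A.1; A.2]).
  rewrite /= inE andbT; by apply/eqP => e; move: h3; rewrite e => /n_Sn.
move=> l; rewrite !inE mem_filter mem_edge_lines => /orP[] /eqP ->.
  by rewrite LE eqxx !orbT.
by rewrite LE h4 eqxx !orbT.
Qed.

Lemma subseq_nodes_lobes : subseq (map fst (nodes C)) (lobes C).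
Proof.
rewrite /nodes /lobes; elim: (ferns C) => //= f F IHF; rewrite map_cat;
  apply: cat_subseq => //.
elim: (fern_lobes f) => // l [|l' s] //= IHs; by rewrite eqxx.
Qed.

Lemma perm_support_lines :
  perm_eq (support_lines C) (axis_line C :: map (fun A => right_line A.1) (nodes C)).
Proof.
apply: uniq_perm; first by rewrite filter_uniq ?undup_uniq.
  apply/andP; split.
    by apply/negP => /mapP[A _ e]; have := right_line_neq_axis A.1; rewrite -e eqxx.
  rewrite (map_comp right_line fst); apply: subseq_uniq uniq_right_lines.
  exact: map_subseq subseq_nodes_lobes.
move=> L; rewrite mem_filter mem_undup !inE.
have [->|La] //= := eqVneq L (axis_line C).
rewrite count_edge_lines //; apply: andb_idr => /mapP[A /node_facts[h1 _ _ _] ->].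
apply/flattenP; exists (edge_lines C A.1); first exact: map_f.
by rewrite mem_edge_lines eqxx !orbT.
Qed.

End Lines.

Lemma prod_support_lines C : coaxial C ->
  \prod_(L <- support_lines C) (line_couple C L)%:R =
  (hfact (up_height C))%:R * (hfact (down_height C))%:R *
  \prod_(A <- nodes C) (line_couple C (right_line C A.1))%:R :> rat.
Proof.
move=> cC; rewrite (perm_big _ (perm_support_lines cC)) big_cons big_map /=.
by rewrite /couple natrM /= -/(up_height C) -/(down_height C); congr (_ * _);
  rewrite mulrC.
Qed.

(** Of the two oblique lines through a node, one is parallel to the sides used by the node couple
    and the other is the support line. The four distances involved are the arguments of [betaL] and
    [betaR]. *)
Lemma node_ratio C A : (node_couple C A)%:R / (line_couple C (right_line C A.1))%:R
  = signed_power (lobe_up A.1) (betaL C) (lobe_right A.1)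
    * signed_power (lobe_up A.1) (betaR C) (lobe_right A.1).
Proof.
rewrite /node_couple /cone_sides /right_line /node_point; case: (lobe_up A.1) => /=;
  rewrite /couple !natrM /= -!/(hfactz _) /betaL /betaR; field; by rewrite !hfactz_neq0.
Qed.

Definition geometric_weight (C : config) : rat :=
  weight C * ((\prod_(A <- nodes C) (node_couple C A)%:R)
               / (\prod_(L <- support_lines C) (line_couple C L)%:R)).

Definition squeeze_invariant (C : config) : rat :=
  vdm (segs (extras C true)) * vdm (segs (extras C false)) * config_ends C
  * config_weight C.

Lemma couple_neq0 H f x : (couple H f x)%:R != 0 :> rat.
Proof. by rewrite natrM mulf_neq0 ?hfactz_neq0. Qed.

Lemma geometric_weight_neq0 C : geometric_weight C != 0.
Proof.
apply: mulf_neq0; first exact: weight_neq0.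
apply: mulf_neq0; rewrite ?invr_eq0 prodf_seq_neq0; apply/allP.
  by move=> A _ /=; exact: couple_neq0.
by move=> [[f x] j] _ /=; exact: couple_neq0.
Qed.

Lemma M_geometric C : coaxial C -> lobes C != [::] ->
  (M (region C))%:R = geometric_weight C * squeeze_invariant C.
Proof.
move=> cC lC; rewrite (M_region_factor cC lC) (vdm_full cC).
rewrite /geometric_weight /squeeze_invariant.
rewrite /weight !Delta_labels // (prod_support_lines cC).
under eq_bigr do rewrite -node_ratio.
rewrite big_split prodfV /= !invfM.
move: (\prod_(A <- _) _) (\prod_(A <- _) _)^-1 (_%:R^-1) (_%:R^-1) => p q r r'; ring.
Qed.

(** * Invariance under squeezing *)

Fixpoint alt_sum (o up : bool) (s : seq nat) : nat :=
  if s is a :: s' then ((if up == o then a else 0) + alt_sum o (~~ up) s')%N else 0%N.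

Lemma alt_sum_cat o up s1 s2 :
  alt_sum o up (s1 ++ s2) = (alt_sum o up s1 + alt_sum o (up (+) odd (size s1)) s2)%N.
Proof.
elim: s1 up => [|a s IHs] up /=; first by rewrite addbF.
by rewrite IHs addNb addbN addnA.
Qed.

Lemma size_segs_pairs C o : size (segs (pairs C o)) =
  (\sum_(f <- ferns C) alt_sum o (fern_up f) (fern_sides f))%N.
Proof.
rewrite /pairs /lobes; elim: (ferns C) => [|[x up s] F IHF] /=; first by rewrite big_nil.
rewrite big_cons filter_cat map_cat segs_cat size_cat IHF; congr addn.
rewrite /fern_lobes /=; elim: s x up 0%N {IHF} => //= a s IHs x up j.
by case: eqP => _; rewrite /= ?(IHs _ _ j.+1) // /segs /= size_cat size_irange (IHs _ _ j.+1).
Qed.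

Section Squeeze.
Variables (R Q : config) (d : nat) (w : bool).
Hypotheses (cR : coaxial R) (cQ : coaxial Q) (lR : lobes R != [::]) (lQ : lobes Q != [::]).
Hypothesis outerQ : outer Q = squeeze_hexagon w d%:Z (outer R).
Hypothesis axisQ : axis Q = axis R.

(** For either orientation the four oblique sides move by d in the same sense; only top and bottom
    depend on [w]. Hence corners, axis segment and the functions [betaL], [betaR] are all translated
    by d. *)
Lemma squeeze_sides :
  [/\ nw (outer Q) = nw (outer R) + d%:Z, se (outer Q) = se (outer R) + d%:Z,
  sw (outer Q) = sw (outer R) + d%:Z & ne (outer Q) = ne (outer R) + d%:Z].
Proof. by rewrite outerQ /squeeze_hexagon; case: w. Qed.

Lemma squeeze_left_extra o :
  left_extra Q o = ((left_extra R o).1 + d%:Z, (left_extra R o).2).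
Proof.
have [e1 e2 e3 e4] := squeeze_sides; rewrite /left_extra e1 e3 axisQ.
by case: o => /=; congr (_, pos _); clear; lia.
Qed.

Lemma squeeze_right_extra o :
  right_extra Q o = ((right_extra R o).1 + d%:Z, (right_extra R o).2).
Proof.
have [e1 e2 e3 e4] := squeeze_sides; rewrite /right_extra e2 e4 axisQ.
by case: o => /=; congr (_, pos _); clear; lia.
Qed.

Lemma squeeze_segs_extras o : segs (extras Q o) = map (+%R^~ d%:Z) (segs (extras R o)).
Proof.
rewrite /extras squeeze_left_extra squeeze_right_extra /segs /= !cats0 map_cat.
by rewrite !irange_shift.
Qed.

Lemma squeeze_axis_left : axis_left Q = axis_left R + d%:Z.
Proof.
have [e1 e2 e3 e4] := squeeze_sides; rewrite /axis_left e1 e3 axisQ addr_maxl.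
by congr Num.max; clear; lia.
Qed.

Lemma squeeze_axis_right : axis_right Q = axis_right R + d%:Z.
Proof.
have [e1 e2 e3 e4] := squeeze_sides; rewrite /axis_right e2 e4 axisQ addr_minl.
by congr Num.min; clear; lia.
Qed.

Lemma squeeze_axis_length : axis_length Q = axis_length R.
Proof.
by rewrite /axis_length squeeze_axis_left squeeze_axis_right; congr absz; clear; lia.
Qed.

Lemma squeeze_betaL x : betaL Q (x + d%:Z) = betaL R x.
Proof.
have [e1 e2 e3 e4] := squeeze_sides; rewrite /betaL e1 e3 axisQ.
by congr (hfactz _ / hfactz _); clear; lia.
Qed.

Lemma squeeze_betaR x : betaR Q (x + d%:Z) = betaR R x.
Proof.
have [e1 e2 e3 e4] := squeeze_sides; rewrite /betaR e2 e4 axisQ.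
by congr (hfactz _ / hfactz _); clear; lia.
Qed.

Lemma squeeze_left_up : left_up Q = left_up R.
Proof.
have [e1 e2 e3 e4] := squeeze_sides; rewrite /left_up e1 e3 axisQ; clear; lia.
Qed.

Lemma squeeze_right_up : right_up Q = right_up R.
Proof.
have [e1 e2 e3 e4] := squeeze_sides; rewrite /right_up e2 e4 axisQ; clear; lia.
Qed.

Lemma squeeze_fern_ends f g : fern_left g = fern_left f + d%:Z -> fern_up g = fern_up f ->
  sumn (fern_sides g) = sumn (fern_sides f) -> size (fern_sides g) = size (fern_sides f) ->
  fern_ends (left_up Q) (betaL Q) g * fern_ends (right_up Q) (betaR Q) g
  = fern_ends (left_up R) (betaL R) f * fern_ends (right_up R) (betaR R) f.
Proof.
move=> e1 e2 e3 e4; rewrite /fern_ends /fern_last /fern_right e1 e2 e3 e4.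
rewrite squeeze_left_up squeeze_right_up addrAC /signed_power.
by rewrite !squeeze_betaL !squeeze_betaR.
Qed.

Lemma squeeze_up_height : (up_height Q)%:Z = (up_height R)%:Z + (if w then - d%:Z else d%:Z).
Proof.
have := up_heightE cQ lQ; have := up_heightE cR lR; rewrite axisQ outerQ.
by rewrite /squeeze_hexagon; case: w => /=; clear; lia.
Qed.

Lemma squeeze_down_height :
  (down_height Q)%:Z = (down_height R)%:Z + (if w then d%:Z else - d%:Z).
Proof.
have := down_heightE cQ lQ; have := down_heightE cR lR; rewrite axisQ outerQ.
by rewrite /squeeze_hexagon; case: w => /=; clear; lia.
Qed.

Variables (F1 F2 : seq fern) (x : int) (up : bool) (s1 s2 : seq nat) (a b : nat).
Hypothesis fernsR : ferns R = F1 ++ Fern x up (s1 ++ [:: a, b & s2]) :: F2.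
Hypothesis fernsQ : ferns Q = map (shift_fern d%:Z) F1
  ++ Fern (x + d%:Z) up (s1 ++ [:: (a - d)%N, (b + d)%N & s2]) :: map (shift_fern d%:Z) F2.
Hypotheses (da : (d <= a)%N) (wE : w = up (+) odd (size s1)).

Lemma squeeze_sumn : sumn (s1 ++ [:: (a - d)%N, (b + d)%N & s2]) = sumn (s1 ++ [:: a, b & s2]).
Proof. by rewrite !sumn_cat /=; move: da; clear; lia. Qed.

Lemma squeeze_axis_segs : axis_segs Q = map (+%R^~ d%:Z) (axis_segs R).
Proof.
have shF F : segs (map fern_pair (map (shift_fern d%:Z) F))
    = map (+%R^~ d%:Z) (segs (map fern_pair F)).
  by elim: F => //= f F IHF; rewrite /segs /= map_cat irange_shift -[flatten _]/(segs _) IHF.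
rewrite /axis_segs fernsR fernsQ !map_cat /= !segs_cat map_cat !shF; congr (_ ++ _).
rewrite -cat1s segs_cat -[in RHS]cat1s segs_cat map_cat !shF; congr (_ ++ _).
by rewrite /segs /fern_pair /= !cats0 squeeze_sumn irange_shift.
Qed.

Lemma squeeze_config_ends : config_ends Q = config_ends R.
Proof.
rewrite /config_ends fernsR fernsQ !big_cat /= !big_cons !big_map.
congr (_ * (_ * _)).
- by apply: eq_bigr => f _; apply: squeeze_fern_ends.
- by apply: squeeze_fern_ends; rewrite //= ?squeeze_sumn // !size_cat.
- by apply: eq_bigr => f _; apply: squeeze_fern_ends.
Qed.

(** The change equals that of the height of the same half in [squeeze_up_height] and
    [squeeze_down_height], so the size demanded of K is unchanged. *)
Lemma squeeze_size o : (size (segs (full_pairs Q o)))%:Z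
  = (size (segs (full_pairs R o)))%:Z + (if w == o then - d%:Z else d%:Z).
Proof.
rewrite /full_pairs !(segs_cat (pairs _ _)) !(size_cat (segs (pairs _ _))).
rewrite squeeze_segs_extras size_map !size_segs_pairs.
rewrite fernsR fernsQ !big_cat /= !big_cons !big_map /= !alt_sum_cat -wE /=.
move: (\sum_(_ <- F1) _)%N (\sum_(_ <- F2) _)%N (alt_sum _ _ s1) (alt_sum _ _ s2) (size _).
by move: da; clear; case: w; case: o => /=; lia.
Qed.

Lemma squeeze_invariantE : squeeze_invariant Q = squeeze_invariant R.
Proof.
rewrite /squeeze_invariant squeeze_config_ends !squeeze_segs_extras.
rewrite !(vdm_map _ (dist_shift _)); congr (_ * _).
rewrite /config_weight squeeze_axis_left squeeze_axis_length squeeze_axis_segs.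
rewrite !squeeze_segs_extras.
rewrite -!map_cat cut_weight_shift !squeeze_size squeeze_up_height squeeze_down_height.
by congr cut_weight; clear; case: w => /=; lia.
Qed.

End Squeeze.

Lemma squeeze_lobes R Q : squeeze R Q -> (lobes R != [::]) && (lobes Q != [::]).
Proof.
have ne C F1 F2 x up s1 a s2 : ferns C = F1 ++ Fern x up (s1 ++ a :: s2) :: F2 ->
    lobes C != [::].
  move=> fC; rewrite /lobes fC map_cat flatten_cat /= -size_eq0 !size_cat /fern_lobes /=.
  by case: s1 {fC} => [|a' s1] /=; lia.
by case=> F1 F2 x up s1 s2 a b d fR _ _ _ _ fQ;
  rewrite (ne _ _ _ _ _ _ _ _ fR) (ne _ _ _ _ _ _ _ _ fQ).
Qed.

Lemma squeeze_geometric R Q : coaxial R -> squeeze R Q -> exists e,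
  [/\ coaxial Q, (M (region R))%:R = geometric_weight R * e &
      (M (region Q))%:R = geometric_weight Q * e].
Proof.
move=> cR RQ; have /andP[lR lQ] := squeeze_lobes RQ.
case: RQ => F1 F2 x up s1 s2 a b d fR /andP[_ da] cQ oQ aQ fQ.
exists (squeeze_invariant R); split=> //; first exact: M_geometric.
by rewrite -(squeeze_invariantE cR cQ lR lQ oQ aQ fR fQ da) // M_geometric.
Qed.

(** The case [R = Q] is kept apart because the empty sequence of squeezings does not guarantee a
    lobe, which [M_geometric] requires. *)
Lemma squeezings_geometric R Q : coaxial R -> squeezings R Q ->
  R = Q \/ exists e, (M (region R))%:R = geometric_weight R * e /\
                     (M (region Q))%:R = geometric_weight Q * e.
Proof.
move=> cR RQ; elim: RQ cR => [C _|R1 R2 Q1 sq _ IH cR]; first by left.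
right; have [e [cR2 MR1 MR2]] := squeeze_geometric cR sq.
case: (IH cR2) => [<-|[e' [MR2' MQ]]]; first by exists e.
exists e; split=> //; rewrite MQ; congr (_ * _).
(* Two factorizations of the same tiling count have equal cofactors because the weight is nonzero;
   the count itself is never inverted. *)
by apply: (mulfI (geometric_weight_neq0 R2)); rewrite -MR2' MR2.
Qed.

Theorem theorem5p2 (R Q : config) (R_coaxial : coaxial R)
    (R_nondegenerate : nondegenerate R) (RQ : squeezings R Q)
    (MQ_neq0 : M (region Q) <> 0%N) :
  (M (region R))%:R / (M (region Q))%:R =
  (weight R * ((\prod_(A <- nodes R) (node_couple R A)%:R)
               / (\prod_(L <- support_lines R) (line_couple R L)%:R)))
  / (weight Q * ((\prod_(A <- nodes Q) (node_couple Q A)%:R)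
                 / (\prod_(L <- support_lines Q) (line_couple Q L)%:R))) :> rat.
Proof.
rewrite -/(geometric_weight R) -/(geometric_weight Q).
have MQ0 : (M (region Q))%:R != 0 :> rat by rewrite pnatr_eq0; apply/eqP.
have [->|[e [-> MQ]]] := squeezings_geometric R_coaxial RQ.
  by rewrite !divff ?geometric_weight_neq0.
have e0 : e != 0 by apply: contraNneq MQ0 => e0; rewrite MQ e0 mulr0.
by rewrite MQ -mulf_div divff // mulr1.
Qed.
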